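(* Assume $a\le p$ and $\bar\beta_{FT}>\beta_*$. Let $L\in\mathbb R$ if $a<p$, and $L<0$ if $a=p$. Let $\beta_*<\beta<\bar\beta_{FT}$, $t>0$ and $\ell\in\mathbb N_L$. Then $$\lim_{N\to\infty}\frac1{c_Nt}\int_0^{c_Nt}\mathbb 1_{\{X^N(s)=\ell\}}\,ds=\pi^L_\ell\qquad\text{in probability,}$$ where $$c_N=c_N^L(\beta)=e^{\beta\left(\beta_*N-\frac{\log N+\kappa}{2\beta_*}\right)}e^{-\beta(\beta_*aN+\sqrt{aN}\,L)},\qquad \mathbb N_L=\{i\ge1:W_i>L\},\qquad \pi^L_\ell=\frac{\gamma_\ell}{\sum_{i\in\mathbb N_L}\gamma_i}.$$
   Context: Environment. Fix $p,a\in(0,1)$ with $a\le p$. For $N\in\mathbb N$ put $N_1=[pN]$ (integer part), $N_2=N-N_1$, $\mathcal V_n=\{-1,1\}^n$, and write $\sigma\in\mathcal V_N$ as $\sigma=\sigma_1\sigma_2$, $\sigma_1\in\mathcal V_{N_1}$, $\sigma_2\in\mathcal V_{N_2}$. Let $\{\Xi^{(1)}_{\sigma_1},\Xi^{(2)}_{\sigma_1\sigma_2}\}$ be independent standard Gaussians and $\Xi_\sigma=\sqrt a\,\Xi^{(1)}_{\sigma_1}+\sqrt{1-a}\,\Xi^{(2)}_{\sigma_1\sigma_2}$. Let $\beta_*=\sqrt{2\log2}$, $\kappa=\log\log2+\log4\pi$, $\bar\beta_{FT}=\frac{1-p}{2a}\beta_*$, and $u_N(x)=\frac{x}{\beta_*\sqrt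 N}+\beta_*\sqrt N-\frac{\log N+\kappa}{2\beta_*\sqrt N}$. Label configurations as $\sigma(i)=\sigma_1(i)\sigma_2(i)$, $1\le i\le2^N$, so that $\Xi_{\sigma(1)}>\Xi_{\sigma(2)}>\cdots$. Put $\gamma^N(\sigma)=e^{\frac{\beta}{\beta_*}u_N^{-1}(\Xi_\sigma)}$. Limit objects. $\xi_1>\xi_2>\cdots$ are the ranked points of a Poisson point process on $\mathbb R$ with intensity $Ke^{-x}dx$ ($K=1$ if $a<p$, $K=\frac12$ if $a=p$); $W_1,W_2,\dots$ are i.i.d., independent of $(\xi_i)$, centered Gaussian of variance $1-a$ (conditioned on being negative if $a=p$); $\gamma_i=e^{\frac{\beta}{\beta_*}\xi_i}$ (a.s. $\sum_i\gamma_i<\infty$ for $\beta>\beta_*$). Skorohod representation. The environments for all $N$ and the limit objects are realized on one probability space on which the following hold (everywhere on the event considered): $u_N^{-1}(\Xi_{\sigma(i)})\to\xi_i$ and $\Xi^{(1)}_{\sigma_1(i)}-\sqrt{aN}\beta_*\to W_i$ for every $i\ge1$; $\sum_{\sigma_2\in\mathcal V_{N_2}}\gamma^N(\sigma_1(i)\sigma_2)\to\gamma_i$ for every $i\ge1$, and $\sum_{\sigma\in\mathcal V_N}\gamma^N(\sigma)\to\sum_{i\ge1}\gamma_i$. ''In probability'' refers to the dynamics on such an environment. Dynamics. Given the environment, $\sigma^N=\{\sigma^N(t),t\ge0\}$ is the continuous-time Markov jump process on $\mathcal V_N$, with uniform initial distribution on $\mathcal V_N$, with jump rate from $\sigma$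 to $\sigma'$ equal to $\frac1Ne^{-\beta\sqrt N\Xi_\sigma}$ if $\sigma,\sigma'$ differ in exactly one coordinate and that coordinate belongs to the first component, equal to $\frac1Ne^{-\beta\sqrt{(1-a)N}\,\Xi^{(2)}_\sigma}$ if they differ in exactly one coordinate and it belongs to the second component, and $0$ otherwise. Set $\phi(\sigma_1\sigma_2)=\min\{i\in\{1,\dots,2^N\}:\sigma_1(i)=\sigma_1\}$ and $X^N(t)=\phi(\sigma^N(t))$. *)

(* Defs.v *)
From HB Require Import structures.
From mathcomp Require Import all_boot all_order all_algebra.
From mathcomp Require Import all_classical all_reals all_analysis.
From mathcomp Require Import ring.

Set Implicit Arguments.
Unset Strict Implicit.
Unset Printing Implicit Defensive.

Import Order.TTheory GRing.Theory Num.Theory.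
Import numFieldNormedType.Exports.

Local Open Scope classical_set_scope.
Local Open Scope ring_scope.

(* The spin space {-1,1}^n; [true] and [false] stand for the two spin values,
   whose numerical values are never used. *)
Notation cube n := {ffun 'I_n -> bool}.

Section Scaling.
Context {R : realType}.

Definition beta_star : R := Num.sqrt (2 * ln 2).

Definition kappa : R := ln (ln 2) + ln (4 * pi).

Definition beta_FT (p a : R) : R := (1 - p) / (2 * a) * beta_star.

Definition uN (N : nat) (x : R) : R :=
  x / (beta_star * Num.sqrt N%:R) + beta_star * Num.sqrt N%:R
  - (ln N%:R + kappa) / (2 * beta_star * Num.sqrt N%:R).

Definition uN_inv (N : nat) (y : R) : R :=
  (y - beta_star * Num.sqrt N%:R
   + (ln N%:R + kappa) / (2 * beta_star * Num.sqrt N%:R))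
  * (beta_star * Num.sqrt N%:R).

Lemma beta_star_sqrtN_neq0 (N : nat) :
  (0 < N)%N -> beta_star * Num.sqrt N%:R != 0 :> R.
Proof.
move=> N0; rewrite gt_eqF// mulr_gt0// sqrtr_gt0 ?ltr0n//.
by rewrite mulr_gt0// ln_gt0// ltr1n.
Qed.

Lemma uNK (N : nat) : (0 < N)%N -> cancel (uN N) (uN_inv N).
Proof.
move=> N0 x; rewrite /uN_inv /uN.
set b := beta_star * _; set k := (_ + _) / _.
have -> : x / b + b - k - b + k = x / b by ring.
by rewrite mulfVK// beta_star_sqrtN_neq0.
Qed.

Lemma uN_invK (N : nat) : (0 < N)%N -> cancel (uN_inv N) (uN N).
Proof.
move=> N0 y; rewrite /uN_inv /uN mulfK ?beta_star_sqrtN_neq0//.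
set b := beta_star * _; set k := (_ + _) / _.
by ring.
Qed.

Definition cN (a beta L : R) (N : nat) : R :=
  expR (beta * (beta_star * N%:R - (ln N%:R + kappa) / (2 * beta_star))) *
  expR (- (beta * (beta_star * a * N%:R + Num.sqrt (a * N%:R) * L))).

End Scaling.

Section Environment.
Context {R : realType}.

Definition N1 (p : R) (N : nat) : nat := Num.truncn (p * N%:R).
Definition N2 (p : R) (N : nat) : nat := (N - N1 p N)%N.

(* The pair (sigma_1, sigma_2) is sigma = sigma_1 sigma_2 in {-1,1}^N. *)
Definition config (p : R) (N : nat) : finType :=
  (cube (N1 p N) * cube (N2 p N))%type.

Section FixedN.
Variables (p a : R) (N : nat).
Implicit Types s : config p N.
Implicit Types Xi : config p N -> R.

Definition XiN (g1 : cube (N1 p N) -> R) (g2 : config p N -> R) s : R :=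
  Num.sqrt a * g1 s.1 + Num.sqrt (1 - a) * g2 s.

(* All configurations, sorted by decreasing value of Xi. *)
Definition ranking Xi : seq (config p N) :=
  sort (fun s s' : config p N => Xi s' <= Xi s) (enum (config p N)).

(* Ranks start from 0 throughout: [ranked Xi i] is sigma(i+1). The default
   value of [nth] is reached only when 2^N <= i. *)
Definition ranked Xi (i : nat) : config p N :=
  nth ([ffun=> true], [ffun=> true]) (ranking Xi) i.

(* phi (sigma_1 sigma_2) - 1: the least rank i such that
   (ranked Xi i).1 = sigma_1. *)
Definition phi Xi s : nat := find (fun s' => s'.1 == s.1) (ranking Xi).

Definition gammaN (beta : R) Xi s : R :=
  expR (beta / beta_star * uN_inv N (Xi s)).

Definition differ1 n (s s' : cube n) : bool :=
  #|[set i | s i != s' i]%SET| == 1%N.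

Definition rate (beta : R) (g1 : cube (N1 p N) -> R) (g2 : config p N -> R)
    (s s' : config p N) : R :=
  if differ1 s.1 s'.1 && (s.2 == s'.2) then
    N%:R^-1 * expR (- (beta * Num.sqrt N%:R * XiN g1 g2 s))
  else if (s.1 == s'.1) && differ1 s.2 s'.2 then
    N%:R^-1 * expR (- (beta * Num.sqrt ((1 - a) * N%:R) * g2 s))
  else 0.

End FixedN.

(* The convergences required of a Skorohod representation, for one realization
   (g1 N, g2 N) of the environments and (xi, W) of the limit objects. *)
Definition skorohod_convergence (p a beta : R)
    (g1 : forall N, cube (N1 p N) -> R) (g2 : forall N, config p N -> R)
    (xi W : nat -> R) : Prop :=
  let Xi N := XiN a (g1 N) (g2 N) in
  let gamma i := expR (beta / beta_star * xi i) in
  [/\ forall i, (fun N => uN_inv N (Xi N (ranked (Xi N) i))) @ \oo --> xi i,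
      forall i, (fun N => g1 N (ranked (Xi N) i).1
                          - Num.sqrt (a * N%:R) * beta_star) @ \oo --> W i,
      forall i, (fun N => \sum_(s2 : cube (N2 p N))
                   gammaN beta (Xi N) ((ranked (Xi N) i).1, s2)) @ \oo
                --> gamma i &
      (fun N => (\sum_(s : config p N) gammaN beta (Xi N) s)%:E) @ \oo
        --> (\sum_(0 <= i <oo) (gamma i)%:E)%E].

End Environment.

Section Probability.
Context {R : realType} {d : measure_display} {T : measurableType d}.
Variable P : probability T R.

Definition mutually_independent (I : eqType) (X : I -> {RV P >-> R}) : Prop :=
  forall (s : seq I) (A : I -> set R), uniq s ->
    (forall i, measurable (A i)) ->
    P (\bigcap_(i in [set` s]) X i @^-1` A i)
    = (\prod_(i <- s) P (X i @^-1` A i))%E.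

Definition sigma_of (X : nat -> {RV P >-> R}) : set (set T) :=
  <<s \bigcup_i preimage_set_system setT (X i) measurable >>.

Definition independent_sequences (X Y : nat -> {RV P >-> R}) : Prop :=
  forall A B, sigma_of X A -> sigma_of Y B -> P (A `&` B) = (P A * P B)%E.

(* The points (xi i) form a Poisson point process with intensity measure mu.
   The library's [poisson_pmf 0] is constantly 1, hence the explicit weight. *)
Definition poisson_point_process (mu : set R -> \bar R)
    (xi : nat -> {RV P >-> R}) : Prop :=
  forall (n : nat) (A : 'I_n -> set R) (k : 'I_n -> nat),
    (forall j, measurable (A j)) -> trivIset setT A ->
    (forall j, (mu (A j) < +oo)%E) ->
    P [set w | forall j,
         counting [set i | A j (xi i w)] = (k j)%:R%:E :> \bar R]
    = (\prod_(j < n) (expR (- fine (mu (A j))) * fine (mu (A j)) ^+ k j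
                      / (k j)`!%:R))%:E.

Definition ranked_poisson_process (mu : set R -> \bar R)
    (xi : nat -> {RV P >-> R}) : Prop :=
  poisson_point_process mu xi /\ {ae P, forall w, forall i, xi i.+1 w < xi i w}.

(* The Gaussian variables Xi^(1)_{sigma_1} and Xi^(2)_{sigma_1 sigma_2}. *)
Definition gaussian_disorder (p : R) (N : nat)
    (g1 : cube (N1 p N) -> {RV P >-> R})
    (g2 : config p N -> {RV P >-> R}) : Prop :=
  [/\ forall s1 A, measurable A -> distribution P (g1 s1) A = normal_prob 0 1 A,
      forall s A, measurable A -> distribution P (g2 s) A = normal_prob 0 1 A &
      mutually_independent
        (fun i : (cube (N1 p N) + config p N)%type =>
           match i with inl s1 => g1 s1 | inr s => g2 s end)].

Definition xi_intensity (p a : R) (A : set R) : \bar R :=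
  (\int[lebesgue_measure]_(x in A)
     ((if a == p then 2^-1 else 1) * expR (- x))%:E)%E.

Definition W_law (p a : R) (A : set R) : \bar R :=
  let nu := normal_prob 0 (Num.sqrt (1 - a)) in
  if a == p then
    (fine (nu (A `&` `]-oo, 0[%classic)) / fine (nu `]-oo, 0[%classic))%:E
  else nu A.

Definition limit_objects (p a : R) (xi W : nat -> {RV P >-> R}) : Prop :=
  [/\ ranked_poisson_process (xi_intensity p a) xi,
      forall i A, measurable A -> distribution P (W i) A = W_law p a A,
      mutually_independent W &
      independent_sequences xi W].

End Probability.

Section JumpProcess.
Context {R : realType} {S : finType}.

Definition generator (r : S -> S -> R) (x y : S) : R :=
  if x == y then - \sum_(z | z != x) r x z else r x y.

Definition transition_semigroup (r : S -> S -> R) (pt : R -> S -> S -> R) :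
    Prop :=
  [/\ forall x y, pt 0 x y = (x == y)%:R,
      forall s t x y, 0 <= s -> 0 <= t ->
        pt (s + t) x y = \sum_z pt s x z * pt t z y &
      forall x y, (fun h => (pt h x y - pt 0 x y) / h) @ 0^'+
        --> generator r x y].

Definition cadlag_path (x : R -> S) : Prop :=
  (forall t, 0 <= t -> exists2 e, 0 < e &
     forall s, t <= s < t + e -> x s = x t) /\
  (forall t, 0 < t -> exists y, exists2 e, 0 < e &
     forall s, 0 <= s -> t - e < s < t -> x s = y).

(* X (restricted to times t >= 0) is the continuous-time Markov jump process on
   S with jump rate r x y from x to y <> x and uniform initial distribution. *)
Definition markov_jump_process {d : measure_display} {D : measurableType d}
    (Q : probability D R) (r : S -> S -> R) (X : R -> D -> S) : Prop :=
  [/\ forall t x, 0 <= t -> measurable [set w | X t w = x],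
      forall w, cadlag_path (fun t => X t w) &
      exists2 pt, transition_semigroup r pt &
        forall (n : nat) (t : nat -> R) (x : nat -> S),
          t 0%N = 0 -> (forall i, t i <= t i.+1) ->
          Q [set w | forall i, (i <= n)%N -> X (t i) w = x i]
          = (#|S|%:R^-1 *
             \prod_(i < n) pt (t i.+1 - t i) (x i) (x i.+1))%:E].

End JumpProcess.

Definition converges_in_probability {R : realType}
    {d : nat -> measure_display} {D : forall N, measurableType (d N)}
    (Q : forall N, probability (D N) R) (Y : forall N, D N -> R) (l : R) :
    Prop :=
  forall e, 0 < e ->
    (fun N => Q N [set w | `|Y N w - l| > e]) @ \oo --> 0%E.

Definition occupation {R : realType} (T : R) (x : R -> nat) (l : nat) : R :=
  T^-1 * \int[lebesgue_measure]_(s in `[0, T]) (x s == l)%:R.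

Definition pi_limit {R : realType} (beta L : R) (xi W : nat -> R) (l : nat) :
    R :=
  let gamma i := expR (beta / beta_star * xi i) in
  gamma l / fine (\sum_(0 <= i <oo | (L < W i)%R) (gamma i)%:E)%E.

(* Main.v *)
(* The dynamics is reversible with respect to the weights gamma^N, and on the
   time scale T = c_N t its rates are c(x,y) / gamma^N(x) for a symmetric network
   of conductances c: first-level edges have conductance theta/N and the
   second-level edges of the block of sigma_1 have conductance
   theta exp (beta sqrt(aN) Xi^(1)_{sigma_1}) / N, where
   theta = t exp (- beta (beta_* a N + sqrt(aN) L)).

   - If L < W_i, the effective resistance between sigma(i) and the uniform
     distribution tends to 0: one spreads inside the block through the
     second-level edges, then through 2^{N_2} parallel copies of the first-level
     cube, and this is where beta < beta_FT enters.  The occupation times of two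
     such states sigma(i), sigma(j) are then asymptotically proportional to
     gamma_i, gamma_j, in L^2 and from any initial state, because the potential
     of a dipole at sigma(i), sigma(j) is bounded by the resistance.

   - Everything else is rarely visited from the uniform distribution m.  The
     density q of the killed occupation measure solves gamma q + Delta q = m
     (Delta the nonnegative Laplacian of the network); q has bounded mean since
     some sigma(l) with L < W_l is well connected to m, and testing the equation
     against {q > k} together with B, the top states with W_i < L, bounds the
     mass of q by m(B) + m(q)/k + k (c(B) + gamma(rest)).  Here c(B), the total
     conductance of B, tends to 0 and gamma(rest) is the tail of
     sum_i gamma_i.

   The process is handled through its skeleton chains at times k c_N t / n,
   n -> oo, which need only the generator at time 0. *)

From HB Require Import structures.
Require Import Defs.
From mathcomp Require Import all_boot all_order all_algebra.
From mathcomp Require Import all_classical all_reals all_analysis.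
From mathcomp Require Import measurable_realfun ring lra.

Set Implicit Arguments.
Unset Strict Implicit.
Unset Printing Implicit Defensive.

Import Order.TTheory GRing.Theory Num.Theory.
Import numFieldNormedType.Exports.

Local Open Scope classical_set_scope.
Local Open Scope ring_scope.

(** * Electrical networks on finite sets *)

Section Network.
Context {R : realType} {S : finType}.
Implicit Types (c : S -> S -> R) (f v gam : S -> R).

Definition lap c f x : R := \sum_y c x y * (f x - f y).

(** The Dirichlet energy. The double sum meets each edge in both orientations, hence the factor
    [2^-1]. *)
Definition energy c f : R := 2^-1 * \sum_x \sum_y c x y * (f x - f y) ^+ 2.

Definition mean f : R := #|S|%:R^-1 * \sum_x f x.

Definition network c := (forall x y, 0 <= c x y) /\ (forall x y, c x y = c y x).

(** Discrete Green formula. By symmetry of [c], exchanging the two summation variables replaces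
    [v x] by [- v y]; the right side is the average of the two expressions. *)
Lemma sum_lap c v f : network c ->
  \sum_x v x * lap c f x =
  2^-1 * \sum_x \sum_y c x y * ((v x - v y) * (f x - f y)).
Proof.
case=> _ csym.
have E1 : \sum_x v x * lap c f x = \sum_x \sum_y c x y * (v x * (f x - f y)).
  by apply: eq_bigr => x _; rewrite mulr_sumr; apply: eq_bigr => y _; ring.
have E2 : \sum_x v x * lap c f x = \sum_x \sum_y c x y * (v y * (f y - f x)).
  rewrite E1 exchange_big /=; apply: eq_bigr => x _; apply: eq_bigr => y _.
  by rewrite csym.
have -> : \sum_x \sum_y c x y * ((v x - v y) * (f x - f y)) =
   \sum_x v x * lap c f x + \sum_x v x * lap c f x.
  rewrite {1}E1 E2 -big_split /=; apply: eq_bigr => x _.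
  by rewrite -big_split /=; apply: eq_bigr => y _; ring.
by field.
Qed.

Lemma sum_lap_energy c f : network c -> \sum_x f x * lap c f x = energy c f.
Proof. by move=> nc; rewrite sum_lap. Qed.

Lemma sum_lap0 c f : network c -> \sum_x lap c f x = 0.
Proof.
move=> nc; have := sum_lap (fun=> 1) f nc.
under eq_bigr do rewrite mul1r.
move=> ->; rewrite big1 ?mulr0// => x _; rewrite big1// => y _.
by rewrite subrr mul0r mulr0.
Qed.

Lemma sum_lap_sym c f v : network c ->
  \sum_x v x * lap c f x = \sum_x f x * lap c v x.
Proof.
move=> nc; rewrite !sum_lap//; congr (_ * _).
by apply: eq_bigr => x _; apply: eq_bigr => y _; rewrite [X in _ * X]mulrC.
Qed.

Lemma energy_ge0 c f : network c -> 0 <= energy c f.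
Proof.
move=> [c0 _]; rewrite mulr_ge0 ?invr_ge0//.
by apply: sumr_ge0 => x _; apply: sumr_ge0 => y _; rewrite mulr_ge0 ?sqr_ge0.
Qed.

Lemma energy_edge c f x y : network c -> c x y * (f x - f y) ^+ 2 <= energy c f.
Proof.
move=> [c0 csym].
have pos u w : 0 <= c u w * (f u - f w) ^+ 2 by rewrite mulr_ge0 ?sqr_ge0.
have [<-|xy] := eqVneq x y.
  by rewrite subrr expr0n mulr0 energy_ge0//; split.
have -> : c x y * (f x - f y) ^+ 2 =
    2^-1 * (c x y * (f x - f y) ^+ 2 + c y x * (f y - f x) ^+ 2).
  by rewrite (csym y x); field.
rewrite ler_wpM2l ?invr_ge0// (bigD1 x)//= lerD//.
  by rewrite (bigD1 y)//= lerDl sumr_ge0.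
rewrite (bigD1 y) 1?eq_sym//= (bigD1 x)//= -addrA lerDl addr_ge0 ?sumr_ge0//.
by move=> u _; rewrite sumr_ge0.
Qed.

(** At a minimiser of [f] every term of the Laplacian is nonpositive, so the hypothesis there forces
    the minimum itself to be nonnegative. *)
Lemma minimum_principle c gam f : network c -> (forall x, 0 < gam x) ->
  (forall x, 0 <= gam x * f x + lap c f x) -> forall x, 0 <= f x.
Proof.
move=> [c0 _] gam0 sup x0.
case: (@arg_minP _ _ S x0 predT f isT) => x _ xmin.
apply: le_trans (xmin x0 isT).
rewrite -(pmulr_rge0 _ (gam0 x)); apply: le_trans (sup x) _.
rewrite gerDl; apply: sumr_le0 => y _.
by rewrite mulr_ge0_le0 ?subr_le0 ?xmin.
Qed.

Lemma lapN c f x : lap c (fun y => - f y) x = - lap c f x.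
Proof. by rewrite /lap -sumrN; apply: eq_bigr => y _; ring. Qed.

(** The operator is an endomorphism of a finite-dimensional space. The minimum principle, applied to
    [u] and to [- u], makes it injective, hence invertible. *)
Lemma resolvent_exists c gam b : network c -> (forall x, 0 < gam x) ->
  exists f, forall x, gam x * f x + lap c f x = b x.
Proof.
move=> nc gam0.
pose A (f : {ffun S -> R^o}) : {ffun S -> R^o} :=
  [ffun x => gam x * f x + lap c f x].
have linA : linear A.
  move=> k u v; apply/ffunP => x; rewrite !ffunE /=.
  rewrite /lap.
  have -> : \sum_y c x y * ((k *: u + v) x - (k *: u + v) y) =
      k * (\sum_y c x y * (u x - u y)) + \sum_y c x y * (v x - v y).
    rewrite mulr_sumr -big_split /=; apply: eq_bigr => y _.
    by rewrite !ffunE /GRing.scale /=; ring.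
  by rewrite /GRing.scale /=; ring.
pose A' : {linear {ffun S -> R^o} -> {ffun S -> R^o}} :=
  HB.pack A (GRing.isLinear.Build R _ _ _ A linA).
have kerA u : A u = 0 -> u = 0.
  move=> Au; apply/ffunP => x; rewrite ffunE.
  have Au0 y : gam y * u y + lap c u y = 0.
    by have := congr1 (fun g : {ffun S -> R^o} => g y) Au; rewrite !ffunE.
  apply/eqP; rewrite eq_le; apply/andP; split.
    rewrite -oppr_ge0; apply: (minimum_principle (f := fun y => - u y) nc gam0).
    by move=> y; rewrite lapN mulrN -opprD Au0 oppr0.
  by apply: (minimum_principle (f := u) nc gam0) => y; rewrite Au0.
have ker0 : lker (linfun A') == 0%VS.
  apply/lker0P => u v; rewrite !lfunE /= => E.
  by apply/subr0_eq/kerA; have := raddfB A' u v; rewrite /= => ->; rewrite E subrr.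
exists ((linfun A')^-1%VF [ffun x => b x]) => x.
have := lker0_lfunVK ker0 [ffun x => b x : R^o].
rewrite lfunE /= => /(congr1 (fun g : {ffun S -> R^o} => g x)).
by rewrite !ffunE.
Qed.


(** In variational form: the effective resistance between [i] and the uniform distribution is at
    most [rho]. *)
Definition grounded c (rho : R) (i : S) :=
  forall f, (mean f - f i) ^+ 2 <= rho * energy c f.

Lemma mean_ge0 f : (forall x, 0 <= f x) -> 0 <= mean f.
Proof. by move=> f0; rewrite mulr_ge0 ?invr_ge0 ?ler0n// sumr_ge0. Qed.

Section KilledGreen.
Variables (c : S -> S -> R) (gam q : S -> R) (rho : R) (i : S).
Hypotheses (nc : network c) (gam0 : forall x, 0 < gam x) (rho0 : 0 <= rho).
Hypothesis gi : grounded c rho i.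
Hypothesis qE : forall x, gam x * q x + lap c q x = #|S|%:R^-1.

Let S0 : (0 < #|S|)%N. Proof. by apply/card_gt0P; exists i. Qed.

Lemma green_ge0 x : 0 <= q x.
Proof.
by apply: (minimum_principle nc gam0) => y; rewrite qE invr_ge0 ler0n.
Qed.

(** Here [gam x * q x] is the probability that the process with rates [c x y / gam x], started
    uniformly, is at [x] at an independent exponential time of mean 1. *)
Lemma green_mass : \sum_x gam x * q x = 1.
Proof.
have : \sum_x (gam x * q x + lap c q x) = 1.
  under eq_bigr do rewrite qE.
  by rewrite sumr_const -[LHS]mulr_natr mulVf// pnatr_eq0 -lt0n.
by rewrite big_split /= sum_lap0// addr0.
Qed.

(** Testing the equation against [q] bounds the energy by [mean q], and the total mass 1 gives
    [q i <= (gam i)^-1]. Grounding at [i] then yields a quadratic inequality for [mean q]. *)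
Lemma green_mean : mean q <= 2 / gam i + rho.
Proof.
have E : energy c q <= mean q.
  have -> : mean q = \sum_x q x * (gam x * q x + lap c q x).
    under [RHS]eq_bigr do rewrite qE.
    by rewrite -mulr_suml mulrC.
  under eq_bigr do rewrite mulrDr.
  rewrite big_split /= sum_lap_energy// lerDr sumr_ge0// => x _.
  by rewrite mulrCA mulr_ge0 ?(ltW (gam0 _))// -expr2 sqr_ge0.
have qi : q i <= (gam i)^-1.
  rewrite -div1r ler_pdivlMr// mulrC -green_mass (bigD1 i)//= lerDl sumr_ge0//.
  by move=> x _; rewrite mulr_ge0 ?green_ge0 ?ltW.
have m0 := mean_ge0 green_ge0; have qi0 := green_ge0 i.
have := gi q => /le_trans/(_ (ler_wpM2l rho0 E)).
have r0 := rho0; have [mle _|mlt] := lerP (mean q) (q i); first by lra.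
(* The arithmetic mean of [mean q] and [rho] dominates their geometric mean, which is what [H]
   bounds by. *)
move=> H; suff : mean q - q i <= (mean q + rho) / 2 by lra.
rewrite -(@ler_pXn2r _ 2)// ?nnegrE; [|lra|lra].
apply: le_trans H _.
have : 0 <= (mean q - rho) ^+ 2 by apply: sqr_ge0.
rewrite !expr2; nra.
Qed.

(* Test the equation for [q] against the indicator of {q > k} together with B:
   the edges leaving this set carry current at least - k c(B). *)
Lemma green_occupation (k : R) (B D : {set S}) : 0 < k ->
  \sum_(x in D) gam x * q x <=
  #|B|%:R / #|S|%:R + mean q / k + k * (\sum_(x in B) \sum_y c x y) +
  k * \sum_(x in D :\: B) gam x.
Proof.
move=> k0; have [c0 csym] := nc.
pose E := ([set x | k < q x] :|: B)%SET.
pose v x : R := (x \in E)%:R.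
have gq0 x : 0 <= gam x * q x by rewrite mulr_ge0 ?green_ge0 ?ltW.
have test : \sum_(x in E) gam x * q x + \sum_x v x * lap c q x = #|E|%:R / #|S|%:R.
  have -> : \sum_(x in E) gam x * q x = \sum_x v x * (gam x * q x).
    rewrite big_mkcond; apply: eq_bigr => x _; rewrite /v.
    by case: (x \in E); rewrite (mul1r, mul0r).
  rewrite -big_split /=; under eq_bigr do rewrite -mulrDr qE.
  rewrite -mulr_suml; congr (_ * _).
  rewrite -sum1_card natr_sum [RHS]big_mkcond; apply: eq_bigr => x _.
  by rewrite /v; case: (x \in E).
have flux : - (k * \sum_(x in B) \sum_y c x y) <= \sum_x v x * lap c q x.
  have -> : \sum_x v x * lap c q x = \sum_(x in E) \sum_(y in ~: E) c x y * (q x - q y).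
    rewrite [RHS]big_mkcond /=.
    have -> : \sum_x v x * lap c q x =
       \sum_(x in E) \sum_y c x y * (q x - q y).
      rewrite [RHS]big_mkcond; apply: eq_bigr => x _; rewrite /v.
      by case: (x \in E); rewrite (mul1r, mul0r).
    have -> : \sum_(x in E) \sum_y c x y * (q x - q y) =
        \sum_(x in E) \sum_(y in E) c x y * (q x - q y) +
        \sum_(x in E) \sum_(y in ~: E) c x y * (q x - q y).
      rewrite -big_split /=; apply: eq_bigr => x _.
      rewrite (bigID (mem E))/=; congr (_ + _).
      by apply: eq_bigl => y; rewrite finset.in_setC.
    have -> : \sum_(x in E) \sum_(y in E) c x y * (q x - q y) = 0.
      set s := LHS; suff : s = - s by lra.
      rewrite {1}/s exchange_big /= -sumrN; apply: eq_bigr => x _.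
      by rewrite -sumrN; apply: eq_bigr => y _; rewrite csym; ring.
    by rewrite add0r big_mkcond.
  rewrite mulr_sumr -sumrN big_mkcond [leRHS]big_mkcond.
  (* Every [y] outside [E] has [q y <= k]. If [x] is in [B], then [0 <= q x] bounds the current
     below by [- k * c x y]; if [x] is in [E] but not in [B], then [k < q x] and the current is
     nonnegative. *)
  apply: ler_sum => x _; case: ifPn => xB.
    rewrite /E inE xB orbT mulr_sumr -sumrN.
    rewrite (bigID (mem (~: E)))/= -[leRHS]addr0 lerD//.
      apply: ler_sum => y; rewrite !inE negb_or -leNgt => /andP[qy _].
      by rewrite mulrC -mulrN ler_wpM2l// lerBrDr; have := green_ge0 x; lra.
    by apply: sumr_le0 => y _; rewrite oppr_le0 mulr_ge0// ltW.
  case: ifPn => // xE; apply: sumr_ge0 => y.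
  move: xE; rewrite !inE (negbTE xB) orbF negb_or -leNgt => qx /andP[qy _].
  by rewrite mulr_ge0// subr_ge0 (le_trans qy)// ltW.
have cardE : #|E|%:R / #|S|%:R <= #|B|%:R / #|S|%:R + mean q / k.
  have -> : mean q / k = ((\sum_x q x) / k) / #|S|%:R by rewrite /mean; ring.
  rewrite -mulrDl ler_wpM2r ?invr_ge0// addrC.
  apply: (@le_trans _ _ (#|[set x | (k < q x)%R]%SET|%:R + #|B|%:R)).
    by rewrite -natrD ler_nat /E finset.cardsU leq_subr.
  rewrite lerD2r ler_pdivlMr// -sum1_card natr_sum mulr_suml big_mkcond.
  apply: ler_sum => x _; rewrite inE; case: ifPn => [kq|_]; last exact: green_ge0.
  by rewrite mul1r ltW.
(* A state of [D] outside [E] is outside [B] and has [q x <= k], so [k * gam x] pays for it. *)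
have split : \sum_(x in D) gam x * q x <=
    \sum_(x in E) gam x * q x + k * \sum_(x in D :\: B) gam x.
  rewrite mulr_sumr big_mkcond [X in _ <= X + _]big_mkcond.
  rewrite [X in _ <= _ + X]big_mkcond -big_split /=; apply: ler_sum => x _.
  rewrite !inE; have := gq0 x; have := gam0 x; have := green_ge0 x.
  by case: (x \in D); case: (x \in B); case: (ltP k (q x)) => /= hq h1 h2 h3; nra.
lra.
Qed.

End KilledGreen.

(** [psi x] is the probability of being in [D] at the exponential killing time when starting from
    [x]. Self-adjointness of [lap] moves the resolvent from the indicator of [D] to the uniform
    source, and [green_occupation] applies. *)
Lemma killed_occupation c gam psi (rho k : R) i (B D : {set S}) :
  network c -> (forall x, 0 < gam x) -> 0 <= rho -> grounded c rho i -> 0 < k ->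
  (forall x, gam x * psi x + lap c psi x = gam x * (x \in D)%:R) ->
  mean psi <= #|B|%:R / #|S|%:R + (2 / gam i + rho) / k +
    k * (\sum_(x in B) \sum_y c x y) + k * \sum_(x in D :\: B) gam x.
Proof.
move=> nc gam0 rho0 gi k0 psiE.
have [q qE] := resolvent_exists (fun=> #|S|%:R^-1) nc gam0.
have -> : mean psi = \sum_(x in D) gam x * q x.
  transitivity (\sum_x (gam x * q x + lap c q x) * psi x).
    by rewrite /mean mulr_sumr; apply: eq_bigr => x _; rewrite qE.
  transitivity (\sum_x q x * (gam x * psi x + lap c psi x)).
    under eq_bigr do rewrite mulrDl; under [RHS]eq_bigr do rewrite mulrDr.
    rewrite !big_split /=; congr (_ + _); first by apply: eq_bigr => x _; ring.
    by rewrite [RHS](sum_lap_sym psi q nc); apply: eq_bigr => x _; rewrite mulrC.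
  rewrite [RHS]big_mkcond; apply: eq_bigr => x _; rewrite psiE.
  by case: (x \in D); rewrite ?mulr1 ?mulr0// mulrC.
apply: le_trans (green_occupation nc gam0 qE B D k0) _.
do 2 rewrite lerD2r; rewrite lerD2l ler_pM2r ?invr_gt0//.
exact: green_mean nc gam0 rho0 gi qE.
Qed.

(** The extremes of [f] sit at the poles by a maximum principle. With [d = f i - f j], the energy is
    at most [d]; comparing each pole with the mean through grounding gives
    [d ^+ 2 <= 4 * rho * d]. *)
Lemma dipole_range c gam f (rho : R) i j x :
  network c -> (forall x, 0 < gam x) -> 0 <= rho ->
  grounded c rho i -> grounded c rho j ->
  (forall x, gam x * f x + lap c f x = (x == i)%:R - (x == j)%:R) ->
  [/\ f j <= 0, 0 <= f i, f j <= f x <= f i & f i - f j <= 4 * rho].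
Proof.
move=> nc gam0 rho0 gi gj fE.
(* A source that is nonpositive off [k] and of total 0 gives [g] its maximum at [k]. A maximiser
   elsewhere has a nonpositive value; a smaller value at [k] would then contradict
   [\sum_y gam y * g y = 0]. It is used for [f] at [i] and for [- f] at [j]. *)
have ge b g : (forall y, gam y * g y + lap c g y = b y) ->
    forall k : S, (forall y, y != k -> b y <= 0) -> \sum_y b y = 0 ->
    0 <= g k /\ forall y, g y <= g k.
  move=> gE k bk b0; have [c0 _] := nc.
  have sum0 : \sum_y gam y * g y = 0.
    have : \sum_y (gam y * g y + lap c g y) = 0 by rewrite -[RHS]b0; apply: eq_bigr => y _; rewrite gE.
    by rewrite big_split /= sum_lap0// addr0.
  case: (@arg_maxP _ _ S k predT g isT) => z _ zmax.
  have zmaxk y : g y <= g z by apply: zmax.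
  suff zk : g z <= g k.
    split=> [|y]; last exact: le_trans zk.
    rewrite leNgt; apply/negP => gk0.
    suff : \sum_y gam y * g y < 0 by rewrite sum0 ltxx.
    rewrite (bigD1 k)//= -[ltRHS]addr0 ltr_leD//; first by rewrite pmulr_rlt0.
    apply: sumr_le0 => y _; rewrite mulr_ge0_le0 ?(ltW (gam0 _))//.
    by rewrite (le_trans (zmaxk y))// (le_trans zk)// ltW.
  have [->//|zk] := eqVneq z k.
  have gz : g z <= 0.
    rewrite -(pmulr_rle0 _ (gam0 z)); apply: le_trans (bk z zk).
    rewrite -gE lerDl; apply: sumr_ge0 => y _.
    by rewrite mulr_ge0// subr_ge0.
  rewrite leNgt; apply/negP => kz.
  suff : \sum_y gam y * g y < 0 by rewrite sum0 ltxx.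
  rewrite (bigD1 k)//= -[ltRHS]addr0 ltr_leD//.
    by rewrite pmulr_rlt0// (lt_le_trans kz).
  apply: sumr_le0 => y _; rewrite mulr_ge0_le0 ?(ltW (gam0 _))//.
  exact: le_trans gz.
have sd (a b : S) : \sum_y ((y == a)%:R - (y == b)%:R : R) = 0.
  have one k : \sum_y ((y == k)%:R : R) = 1.
    by rewrite (bigD1 k)//= eqxx big1 ?addr0// => y /negbTE->.
  by rewrite big_split /= sumrN !one subrr.
have [fi0 fi] : 0 <= f i /\ forall y, f y <= f i.
  apply: (ge _ _ fE) => [y /negbTE->|]; last exact: sd.
  by rewrite sub0r oppr_le0.
have [fj0 fj] : 0 <= - f j /\ forall y, - f y <= - f j.
  apply: (ge (fun y => (y == j)%:R - (y == i)%:R) (fun y => - f y)).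
  - by move=> y; rewrite lapN mulrN -opprD fE opprB.
  - by move=> y /negbTE->; rewrite sub0r oppr_le0.
  - exact: sd.
rewrite oppr_ge0 in fj0; split=> //; first by rewrite fi -lerN2 fj.
have E : energy c f <= f i - f j.
  have -> : f i - f j = \sum_x f x * (gam x * f x + lap c f x).
    under [RHS]eq_bigr do rewrite fE mulrBr.
    rewrite big_split /= sumrN; congr (_ - _).
      by rewrite (bigD1 i)//= eqxx mulr1 big1 ?addr0// => y /negbTE->; rewrite mulr0.
    by rewrite (bigD1 j)//= eqxx mulr1 big1 ?addr0// => y /negbTE->; rewrite mulr0.
  under eq_bigr do rewrite mulrDr.
  rewrite big_split /= sum_lap_energy// lerDr sumr_ge0// => y _.
  by rewrite mulrCA mulr_ge0 ?(ltW (gam0 _))// -expr2 sqr_ge0.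
have := gi f => /le_trans/(_ (ler_wpM2l rho0 E)).
have := gj f => /le_trans/(_ (ler_wpM2l rho0 E)).
set m := mean f; set d := f i - f j => hj hi.
have d0 : 0 <= d by rewrite subr_ge0 fi.
have : d ^+ 2 <= 4 * rho * d.
  have := sqr_ge0 ((m - f j) + (m - f i)).
  have -> : ((m - f j) + (m - f i)) ^+ 2 =
      2 * (m - f j) ^+ 2 + 2 * (m - f i) ^+ 2 - d ^+ 2 by rewrite /d; ring.
  lra.
have [->|dn0] := eqVneq d 0; first by rewrite mulr_ge0.
by rewrite expr2 ler_pM2r// lt_def dn0.
Qed.

End Network.

(** [o] is a vector of occupation fractions. Its mass outside [A] is paid twice: once because [b] is
    arbitrary there, once because the fractions in [A] do not quite sum to 1. *)
Lemma occupation_algebra {R : realType} {S : finType} (o gam : S -> R)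
    (A : {set S}) (l : S) (b : S -> bool) :
  (forall x, 0 <= o x) -> \sum_x o x = 1 -> (forall x, 0 < gam x) ->
  l \in A -> {in A, forall x, b x = (x == l)} ->
  `|\sum_x o x * (b x)%:R - gam l / \sum_(x in A) gam x| <=
  2 * \sum_(x in ~: A) o x +
  \sum_(j in A) gam j * `|o l / gam l - o j / gam j|.
Proof.
move=> o0 o1 gam0 lA bA.
set G := \sum_(x in A) gam x; set oD := \sum_(x in ~: A) o x.
have Gl : gam l <= G by rewrite /G (bigD1 l)//= lerDl sumr_ge0// => x _; exact: ltW.
have G0 : 0 < G by exact: lt_le_trans Gl.
have oD0 : 0 <= oD by apply: sumr_ge0.
have oE : \sum_(x in A) o x + oD = 1.
  rewrite -o1 [RHS](bigID (mem A))/=; congr (_ + _).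
  by apply: eq_bigl => x; rewrite finset.in_setC.
set Y := \sum_x _.
have YE : Y = o l + \sum_(x in ~: A) o x * (b x)%:R.
  rewrite /Y (bigID (mem A))/=; congr (_ + _); last first.
    by apply: eq_bigl => x; rewrite finset.in_setC.
  rewrite (bigD1 l)//= bA// eqxx mulr1 big1 ?addr0// => x /andP[xA xl].
  by rewrite bA// (negbTE xl) mulr0.
have Yo : `|Y - o l| <= oD.
  rewrite YE [X in X - _]addrC addrK ger0_norm; last first.
    by apply: sumr_ge0 => x _; rewrite mulr_ge0.
  by apply: ler_sum => x _; case: (b x); rewrite ?mulr1 ?mulr0.
set V := \sum_(j in A) gam j * _.
have ol : `|o l - gam l / G| <= V + oD.
  have -> : o l - gam l / G =
      gam l / G * (\sum_(j in A) gam j * (o l / gam l - o j / gam j) - oD).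
    have -> : \sum_(j in A) gam j * (o l / gam l - o j / gam j) =
        G * (o l / gam l) - (1 - oD).
      rewrite -oE addrK /G mulr_suml -sumrB; apply: eq_bigr => j _.
      by rewrite mulrBr; congr (_ - _); rewrite mulrC divfK// gt_eqF.
    by field; rewrite !gt_eqF.
  rewrite normrM ger0_norm; last by rewrite divr_ge0// ltW.
  apply: (@le_trans _ _ (1 * (V + oD))); last by rewrite mul1r.
  apply: ler_pM => //; first by rewrite divr_ge0// ltW.
    by rewrite ler_pdivrMr// mul1r.
  rewrite (le_trans (ler_normB _ _))// lerD//; last by rewrite ger0_norm.
  rewrite (le_trans (ler_norm_sum _ _ _))//; apply: ler_sum => j _.
  by rewrite normrM ger0_norm// ltW.
have -> : Y - gam l / G = (Y - o l) + (o l - gam l / G) by ring.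
by rewrite (le_trans (ler_normD _ _))//; lra.
Qed.

(** * Skeletons of reversible jump processes *)

Section Skeleton.
Context {R : realType} {S : finType}.
Variable pt : R -> S -> S -> R.
Implicit Types (f g : S -> R).

Definition avg t f x : R := \sum_y pt t x y * f y.

(** Nonnegativity and unit row sums are part of this notion; [process_semigroup] reads them off the
    finite-dimensional laws. *)
Definition markov_semigroup :=
  [/\ forall x y, pt 0 x y = (x == y)%:R,
      forall s t x y, 0 <= s -> 0 <= t ->
        pt (s + t) x y = \sum_z pt s x z * pt t z y,
      forall t x y, 0 <= t -> 0 <= pt t x y &
      forall t x, 0 <= t -> \sum_y pt t x y = 1].

Hypothesis pt_semigroup : markov_semigroup.

Lemma avg0 f x : avg 0 f x = f x.
Proof.
case: pt_semigroup => pt0 _ _ _; rewrite /avg (bigD1 x)//= pt0 eqxx mul1r.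
by rewrite big1 ?addr0// => y; rewrite pt0 eq_sym => /negbTE->; rewrite mul0r.
Qed.

Lemma avgD s t f x : 0 <= s -> 0 <= t -> avg (s + t) f x = avg s (avg t f) x.
Proof.
case: pt_semigroup => _ ptD _ _ s0 t0; rewrite /avg.
under eq_bigr do rewrite ptD// mulr_suml.
rewrite exchange_big; apply: eq_bigr => y _; rewrite mulr_sumr.
by apply: eq_bigr => z _; rewrite mulrA.
Qed.

Lemma avg_lin t (a : R) f g x :
  avg t (fun y => a * f y + g y) x = a * avg t f x + avg t g x.
Proof.
rewrite /avg mulr_sumr -big_split /=; apply: eq_bigr => y _.
by rewrite mulrDr mulrCA.
Qed.

Lemma avgB t f g x : avg t (fun y => f y - g y) x = avg t f x - avg t g x.
Proof.
rewrite /avg -sumrN -big_split /=; apply: eq_bigr => y _.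
by rewrite mulrBr.
Qed.

Lemma avg_cst t (a : R) x : 0 <= t -> avg t (fun=> a) x = a.
Proof.
by case: pt_semigroup => _ _ _ pt1 t0; rewrite /avg -mulr_suml pt1// mul1r.
Qed.

Lemma avg_le t f g x : 0 <= t -> (forall y, f y <= g y) -> avg t f x <= avg t g x.
Proof.
case: pt_semigroup => _ _ pt0 _ t0 fg.
by apply: ler_sum => y _; rewrite ler_wpM2l// pt0.
Qed.

Lemma avg_norm t f x (a : R) : 0 <= t -> (forall y, `|f y| <= a) ->
  `|avg t f x| <= a.
Proof.
move=> t0 fa; rewrite ler_norml; apply/andP; split.
  rewrite -[leLHS](avg_cst _ x t0); apply: avg_le => // y.
  by have := fa y; rewrite ler_norml => /andP[].
rewrite -[leRHS](avg_cst _ x t0); apply: avg_le => // y.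
by have := fa y; rewrite ler_norml => /andP[].
Qed.

Lemma mean_le f g : (forall x, f x <= g x) -> mean f <= mean g.
Proof. by move=> fg; rewrite ler_wpM2l ?invr_ge0// ler_sum. Qed.

Lemma mean_lin (a : R) f g : mean (fun x => a * f x + g x) = a * mean f + mean g.
Proof. by rewrite /mean big_split /= -mulr_sumr mulrDr mulrCA. Qed.

Lemma mean_cst (a : R) : (0 < #|S|)%N -> mean (fun _ : S => a) = a.
Proof.
move=> S0; rewrite /mean sumr_const -[a *+ _]mulr_natr mulrCA mulVf ?mulr1//.
by rewrite pnatr_eq0 -lt0n.
Qed.

(** The hypothesis says that [g / n] is [f - avg t f] up to [eps / n]; summed along the skeleton,
    these differences telescope. *)
Lemma avg_telescope (n : nat) (t eps : R) f g :
  (0 < n)%N -> 0 <= t ->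
  (forall x, `|n%:R * (f x - avg t f x) - g x| <= eps) ->
  forall l x, `|n%:R^-1 * (\sum_(j < l) avg (j%:R * t) g x) -
                (f x - avg (l%:R * t) f x)| <= l%:R / n%:R * eps.
Proof.
move=> n0 t0 fg; elim=> [|l IH] x.
  by rewrite big_ord0 mul0r avg0 subrr mulr0 subrr normr0 !mul0r.
have lt0 : 0 <= l%:R * t by rewrite mulr_ge0.
have nR0 : n%:R != 0 :> R by rewrite pnatr_eq0 -lt0n.
have -> : l.+1%:R * t = l%:R * t + t by rewrite -natr1 mulrDl mul1r.
rewrite big_ord_recr /= avgD// -natr1.
set A := \sum_(_ < _) _.
have -> : n%:R^-1 * (A + avg (l%:R * t) g x) - (f x - avg (l%:R * t) (avg t f) x) =
  (n%:R^-1 * A - (f x - avg (l%:R * t) f x)) -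
  n%:R^-1 * avg (l%:R * t) (fun y => n%:R * (f y - avg t f y) - g y) x.
  rewrite avgB /avg; set a := \sum_y _ * f y; set b := \sum_y _ * g y.
  set d := \sum_y _.
  have -> : \sum_y pt (l%:R * t) x y * (n%:R * (f y - \sum_y0 pt t y y0 * f y0)) =
     n%:R * (a - d).
    rewrite /a /d -sumrN -big_split mulr_sumr /=; apply: eq_bigr => y _.
    by ring.
  by field.
have -> : (l%:R + 1) / n%:R * eps = l%:R / n%:R * eps + n%:R^-1 * eps by ring.
rewrite (le_trans (ler_normB _ _))// lerD ?IH//.
rewrite normrM ger0_norm ?invr_ge0// ler_wpM2l ?invr_ge0//.
exact: avg_norm.
Qed.

(** [psi] nearly solves the resolvent equation with unit killing, so occupation of [D] telescopes up
    to a factor [1 + n^-1] per step. This factor undoes the killing, and its accumulated value stays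
    below [expR 2]. *)
Lemma skeleton_occupation (n : nat) (t eps : R) (D : {set S}) psi :
  (0 < #|S|)%N -> (0 < n)%N -> 0 <= t -> 0 <= eps ->
  (forall x, 0 <= psi x) ->
  (forall x, `|n%:R * (psi x - avg t psi x) - ((x \in D)%:R - psi x)| <= eps) ->
  n%:R^-1 * (\sum_(k < n) mean (avg (k.+1%:R * t) (fun x => (x \in D)%:R)))
  <= expR 2 * (mean psi + 2 * eps).
Proof.
move=> S0 n0 t0 eps0 psi0 psiE.
pose e k := mean (avg (k%:R * t) (fun x => (x \in D)%:R)).
pose a k := mean (avg (k%:R * t) psi).
pose b : R := 1 + n%:R^-1.
have kt0 k : 0 <= k%:R * t by rewrite mulr_ge0.
have nR0 : 0 < n%:R :> R by rewrite ltr0n.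
have a0 k : 0 <= a k.
  by apply: mean_ge0 => x; rewrite -(avg_cst 0 x (kt0 k)); exact: avg_le.
have e0 k : 0 <= e k.
  apply: mean_ge0 => x; rewrite -[leLHS](avg_cst 0 x (kt0 k)).
  by apply: avg_le => // y; exact: ler0n.
(* The lower half of the hypothesis on [psi] bounds the indicator of [D] by
   [(n + 1) * psi - n * avg t psi + eps]. *)
have step k : e k / n%:R <= b * a k - a k.+1 + eps / n%:R.
  have -> : b * a k - a k.+1 + eps / n%:R =
    ((n%:R + 1) * a k + (- n%:R * a k.+1 + eps)) / n%:R.
    by rewrite /b; field; rewrite gt_eqF.
  rewrite ler_pM2r ?invr_gt0//.
  have aE : a k.+1 = mean (avg (k%:R * t) (avg t psi)).
    rewrite /a -natr1 mulrDl mul1r; congr (_ * _); apply: eq_bigr => x _.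
    by rewrite avgD.
  rewrite aE /a -[eps in leRHS](mean_cst eps S0) -mean_lin -mean_lin.
  apply: mean_le => x; rewrite -[eps in leRHS](avg_cst eps x (kt0 k)) -avg_lin -avg_lin.
  apply: avg_le => // y; have := psiE y; rewrite ler_norml => /andP[h _].
  lra.
have b1 : 1 <= b by rewrite lerDl invr_ge0 ltW.
pose A l := a 0%N + l%:R / n%:R * eps.
have A0 l : 0 <= A l by rewrite addr_ge0// mulr_ge0// divr_ge0.
have main l : \sum_(k < l) e k / n%:R <= b ^+ l * A l - a l.
  elim: l => [|l IH]; first by rewrite big_ord0 expr0 /A !mul0r addr0 mul1r subrr.
  have al : a l <= b ^+ l * A l.
    suff : 0 <= \sum_(k < l) e k / n%:R by move: IH; lra.
    by apply: sumr_ge0 => k _; rewrite divr_ge0.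
  have bl1 : 1 <= b ^+ l by rewrite exprn_ege1.
  have hA : A l.+1 = A l + eps / n%:R by rewrite /A -natr1; ring.
  rewrite big_ord_recr /= exprS hA; have hs := step l.
  have h1 : (b - 1) * a l <= (b - 1) * (b ^+ l * A l) by rewrite ler_wpM2l ?subr_ge0.
  have h2 : eps / n%:R <= b * b ^+ l * (eps / n%:R).
    by rewrite ler_peMl ?divr_ge0// -exprS exprn_ege1.
  lra.
(* The claim concerns times 1 to [n], so [n.+1] terms are summed and the one at time 0 is dropped
   afterwards. *)
have main1 : \sum_(k < n.+1) e k / n%:R <= b ^+ n.+1 * A n.+1.
  by apply: le_trans (main _) _; rewrite gerBl.
apply: (@le_trans _ _ (b ^+ n.+1 * A n.+1)).
  apply: le_trans main1; rewrite big_ord_recl /= mulr_sumr.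
  rewrite -[leLHS]add0r lerD ?divr_ge0//.
  by apply: ler_sum => k _; rewrite mulrC.
have a0E : a 0%N = mean psi.
  by rewrite /a mul0r; congr (_ * _); apply: eq_bigr => x _; rewrite avg0.
have n1n : n.+1%:R / n%:R <= 2 :> R.
  by rewrite ler_pdivrMr// -natrM ler_nat mul2n -addnn -addn1 leq_add2l.
have bexp : b ^+ n.+1 <= expR 2.
  apply: (@le_trans _ _ (expR n%:R^-1 ^+ n.+1)).
    by rewrite lerXn2r ?nnegrE ?(le_trans _ b1)// ?expR_ge0// expR_ge1Dx.
  by rewrite -expRM_natl ler_expR.
apply: ler_pM => //; first by rewrite exprn_ge0// (le_trans _ b1).
by rewrite /A a0E lerD2l ler_wpM2r.
Qed.

(** Given the state at time [k.+1], the averaged future sum of [g] is small from any starting point: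
    telescoping [f] costs its oscillation [r], the killing term costs another [r], and the
    discretisation costs [eps]. The remaining factor [g] is bounded by [a]. *)
Lemma skeleton_correlation (n k : nat) (t eps r a : R) f g :
  (0 < #|S|)%N -> (0 < n)%N -> 0 <= t -> 0 <= eps ->
  (forall x, `|f x| <= r) -> (forall x y, `|f x - f y| <= r) ->
  (forall x, `|g x| <= a) ->
  (forall x, `|n%:R * (f x - avg t f x) - (g x - f x)| <= eps) ->
  (k <= n)%N ->
  n%:R^-1 * (\sum_(i < n - k)
     mean (avg (k.+1%:R * t) (fun x => g x * avg (i%:R * t) g x)))
  <= a * (2 * r + eps).
Proof.
move=> S0 n0 t0 eps0 fr fosc ga fE kn.
have kt0 (m : nat) : 0 <= m%:R * t by rewrite mulr_ge0.
have nR0 : 0 < n%:R :> R by rewrite ltr0n.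
pose U x := n%:R^-1 * \sum_(i < n - k) avg (i%:R * t) g x.
have -> : n%:R^-1 * (\sum_(i < n - k)
     mean (avg (k.+1%:R * t) (fun x => g x * avg (i%:R * t) g x))) =
   mean (avg (k.+1%:R * t) (fun x => g x * U x)).
  rewrite /mean -mulr_sumr mulrCA; congr (_ * _).
  rewrite exchange_big mulr_sumr; apply: eq_bigr => x _.
  rewrite /avg exchange_big mulr_sumr; apply: eq_bigr => y _.
  rewrite -mulr_sumr -mulr_sumr /U; ring.
have l1 : (n - k)%:R / n%:R <= 1 :> R.
  by rewrite ler_pdivrMr// mul1r ler_nat leq_subr.
have UB x : `|U x| <= 2 * r + eps.
  have := avg_telescope (g := fun y => g y - f y) n0 t0 fE (n - k) x.
  have -> : \sum_(j < n - k) avg (j%:R * t) (fun y => g y - f y) x =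
     \sum_(j < n - k) avg (j%:R * t) g x - \sum_(j < n - k) avg (j%:R * t) f x.
    by rewrite -sumrN -big_split; apply: eq_bigr => j _; rewrite avgB.
  have hs : `|n%:R^-1 * \sum_(j < n - k) avg (j%:R * t) f x| <= r.
    have r0 : 0 <= r by apply: le_trans (fr x).
    rewrite normrM ger0_norm ?invr_ge0// mulrC ler_pdivrMr//.
    apply: (@le_trans _ _ (\sum_(j < n - k) r)).
      apply: le_trans (ler_norm_sum _ _ _) _; apply: ler_sum => j _.
      exact: avg_norm.
    by rewrite sumr_const card_ord -[leLHS]mulr_natr ler_wpM2l// ler_nat leq_subr.
  have hf : `|f x - avg ((n - k)%:R * t) f x| <= r.
    have -> : f x - avg ((n - k)%:R * t) f x = avg ((n - k)%:R * t) (fun y => f x - f y) x.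
      by rewrite avgB avg_cst.
    by apply: avg_norm => //.
  have he : (n - k)%:R / n%:R * eps <= eps by rewrite ler_piMl.
  rewrite mulrBr -/(U x) => h; move: h hs hf.
  set p := n%:R^-1 * _; set q := f x - _; rewrite !ler_norml.
  by move=> /andP[? ?] /andP[? ?] /andP[? ?]; apply/andP; split; lra.
have [x0 _] : exists x : S, x \in S by apply/card_gt0P.
have a0 : 0 <= a by apply: le_trans (ga x0).
rewrite -[leRHS](mean_cst _ S0); apply: mean_le => x.
rewrite -[leRHS](avg_cst _ x (kt0 k.+1)); apply: avg_le => // y.
by rewrite (le_trans (ler_norm _))// normrM ler_pM.
Qed.

End Skeleton.

(** The square is expanded over ordered pairs of indices. Off-diagonal pairs occur twice; doubling
    the diagonal too, through [i = 0], turns the identity into an inequality. *)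
Lemma sqr_sum_le (R : realDomainType) (n : nat) (a : nat -> R) :
  (\sum_(k < n) a k) ^+ 2 <= 2 * \sum_(k < n) \sum_(i < n - k) a k * a (k + i)%N.
Proof.
elim: n a => [|n IH] a; first by rewrite !big_ord0 expr0n mulr0.
rewrite big_ord_recl [in leRHS]big_ord_recl /= subn0 big_ord_recl /= !add0n.
have := IH (fun k => a k.+1).
set s := \sum_(k < n) a k.+1.
have -> : \sum_(i < n) a 0%N * a (bump 0 i) = a 0%N * s.
  by rewrite mulr_sumr.
have -> : \sum_(k < n) \sum_(i < n.+1 - bump 0 k) a (bump 0 k) * a (bump 0 k + i)%N =
   \sum_(k < n) \sum_(i < n - k) a k.+1 * a (k + i).+1.
  by apply: eq_bigr => k _; rewrite /bump /= add1n subSS.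
set v := \sum_(k < n) _; have := sqr_ge0 (a 0%N); rewrite sqrrD !expr2.
lra.
Qed.

(** * Expectations of bounded random variables *)

Section Expectation.
Context {R : realType} {d : measure_display} {D : measurableType d}.
Variable Q : probability D R.
Implicit Types Z : D -> R.

(** A class closed under sums, products and absolute values, whose members are integrable under any
    probability measure. *)
Definition bounded_measurable Z :=
  measurable_fun setT Z /\ exists C, forall v, `|Z v| <= C.

Definition Ex Z : R := \int[Q]_v Z v.

Lemma bm_integrable Z : bounded_measurable Z -> Q.-integrable setT (EFin \o Z).
Proof.
move=> [mZ [C CZ]]; apply: measurable_bounded_integrable => //.
  by rewrite -ge0_fin_numE// fin_num_measure.
exists C; split; first exact: num_real.
by move=> M CM v _ /=; rewrite (le_trans (CZ v))// ltW.
Qed.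

Lemma bmD Z Z' : bounded_measurable Z -> bounded_measurable Z' ->
  bounded_measurable (fun v => Z v + Z' v).
Proof.
move=> [mZ [C CZ]] [mZ' [C' CZ']]; split; first exact: measurable_funD.
by exists (C + C') => v; rewrite (le_trans (ler_normD _ _))// lerD.
Qed.

Lemma bmM Z Z' : bounded_measurable Z -> bounded_measurable Z' ->
  bounded_measurable (fun v => Z v * Z' v).
Proof.
move=> [mZ [C CZ]] [mZ' [C' CZ']]; split; first exact: measurable_funM.
by exists (C * C') => v; rewrite normrM ler_pM.
Qed.

Lemma bm_cst (a : R) : bounded_measurable (fun=> a).
Proof. by split; [exact: measurable_cst|exists `|a|]. Qed.

Lemma bmZ (a : R) Z : bounded_measurable Z -> bounded_measurable (fun v => a * Z v).
Proof. by move=> bZ; exact: bmM (bm_cst a) bZ. Qed.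

Lemma bmB Z Z' : bounded_measurable Z -> bounded_measurable Z' ->
  bounded_measurable (fun v => Z v - Z' v).
Proof.
move=> bZ bZ'; have := bmD bZ (bmZ (-1) bZ').
by congr bounded_measurable; apply/funext => v; rewrite mulN1r.
Qed.

Lemma bm_norm Z : bounded_measurable Z -> bounded_measurable (fun v => `|Z v|).
Proof.
move=> [mZ [C CZ]]; split; first exact: measurableT_comp.
by exists C => v; rewrite normr_id.
Qed.

Lemma bm_sum I (s : seq I) (Z : I -> D -> R) :
  (forall i, bounded_measurable (Z i)) ->
  bounded_measurable (fun v => \sum_(i <- s) Z i v).
Proof.
move=> bZ; elim: s => [|i s IH].
  by under eq_fun do rewrite big_nil; exact: bm_cst.
by under eq_fun do rewrite big_cons; exact: bmD.
Qed.

Lemma ExD Z Z' : bounded_measurable Z -> bounded_measurable Z' ->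
  Ex (fun v => Z v + Z' v) = Ex Z + Ex Z'.
Proof. by move=> bZ bZ'; rewrite /Ex RintegralD//; exact: bm_integrable. Qed.

Lemma ExZ (a : R) Z : bounded_measurable Z -> Ex (fun v => a * Z v) = a * Ex Z.
Proof. by move=> bZ; rewrite /Ex RintegralZl//; exact: bm_integrable. Qed.

Lemma Ex_cst (a : R) : Ex (fun=> a) = a.
Proof. by rewrite /Ex Rintegral_cst// [X in fine X]probability_setT mulr1. Qed.

Lemma Ex_sum I (s : seq I) (Z : I -> D -> R) :
  (forall i, bounded_measurable (Z i)) ->
  Ex (fun v => \sum_(i <- s) Z i v) = \sum_(i <- s) Ex (Z i).
Proof.
move=> bZ; elim: s => [|i s IH].
  by under eq_fun do rewrite big_nil; rewrite Ex_cst big_nil.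
under eq_fun do rewrite big_cons.
by rewrite ExD ?IH ?big_cons//; exact: bm_sum.
Qed.

Lemma Ex_le Z Z' : bounded_measurable Z -> bounded_measurable Z' ->
  (forall v, Z v <= Z' v) -> Ex Z <= Ex Z'.
Proof. by move=> bZ bZ' ZZ'; apply: le_Rintegral => //; exact: bm_integrable. Qed.

Lemma bm_event (A : D -> bool) : measurable [set v | A v] ->
  bounded_measurable (fun v => (A v)%:R).
Proof.
move=> mA.
have -> : (fun v => (A v)%:R) = \1_[set v | A v] :> (D -> R).
  by apply/funext => v; rewrite indicE mem_setE.
by split => //; exists 1 => v; rewrite indicE; case: (_ \in _); rewrite ?normr1 ?normr0.
Qed.

Lemma Ex_event (A : D -> bool) : measurable [set v | A v] ->
  Ex (fun v => (A v)%:R) = fine (Q [set v | A v]).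
Proof.
move=> mA.
have -> : (fun v => (A v)%:R) = \1_[set v | A v] :> (D -> R).
  by apply/funext => v; rewrite indicE mem_setE.
by rewrite /Ex /Rintegral integral_indic// setIT.
Qed.

Lemma Markov_le Z e : bounded_measurable Z -> 0 < e ->
  (Q [set v | (e < `|Z v|)%R] <= (Ex (fun v => `|Z v|) / e)%:E)%E.
Proof.
move=> bZ e0.
have mA : measurable [set v | e < `|Z v|].
  have [mZ _] := bm_norm bZ.
  have := mZ measurableT _ (measurable_itv `]e, +oo[); rewrite setTI.
  by congr measurable; apply/seteqP; split => v /=; rewrite in_itv/= andbT.
rewrite -[leLHS]fineK ?fin_num_measure// lee_fin ler_pdivlMr//.
rewrite -(Ex_event (A := fun v => e < `|Z v|))// mulrC -ExZ; last exact: bm_event.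
apply: Ex_le; [by apply: bmZ; exact: bm_event|exact: bm_norm|] => v.
by case: ltP => [/ltW|_]; rewrite ?mulr1 ?mulr0.
Qed.

End Expectation.

(** * Two-time laws of a Markov jump process *)

Section Process.
Context {R : realType} {S : finType} {d : measure_display} {D : measurableType d}.
Variables (Q : probability D R) (r : S -> S -> R) (X : R -> D -> S).
Hypothesis mp : markov_jump_process Q r X.

Lemma process_event t x : 0 <= t -> measurable [set v | X t v == x].
Proof.
move=> t0; have [m _ _] := mp; have := m t x t0.
by congr measurable; apply/seteqP; split => v /= /eqP.
Qed.

Lemma bm_process t (f : S -> R) : 0 <= t -> bounded_measurable (fun v => f (X t v)).
Proof.
move=> t0.
have -> : (fun v => f (X t v)) = fun v => \sum_x f x * (X t v == x)%:R.
  apply/funext => v; rewrite (bigD1 (X t v))//= eqxx mulr1 big1 ?addr0// => y.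
  by rewrite eq_sym => /negbTE->; rewrite mulr0.
by apply: bm_sum => x; apply: bmZ; apply: bm_event; exact: process_event.
Qed.

Lemma card_state_gt0 : (0 < #|S|)%N.
Proof.
rewrite lt0n; apply/negP => /eqP S0.
have : Q setT = Q set0.
  by congr (Q _); apply/seteqP; split => // v _; have := fintype0 (X 0 v) S0.
by rewrite probability_setT measure0 => /eqP; rewrite eqe oner_eq0.
Qed.

(** Everything follows from the joint law at times 0, [s] and [t]; time 0 is included because the
    finite-dimensional laws are given from the initial time on. *)
Lemma process_semigroup : exists pt : R -> S -> S -> R,
  [/\ markov_semigroup pt,
      forall x y, (fun h => (pt h x y - pt 0 x y) / h) @ 0^'+ --> generator r x y &
      forall s t (f g : S -> R), 0 <= s -> s <= t ->
        Ex Q (fun v => f (X s v) * g (X t v)) =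
        mean (avg pt s (fun x => f x * avg pt (t - s) g x))].
Proof.
have [_ _ [pt [pt0 ptD ptgen] law]] := mp.
have joint s t x0 x y : 0 <= s -> s <= t ->
    Q [set v | (X 0 v == x0) && (X s v == x) && (X t v == y)] =
    (#|S|%:R^-1 * (pt s x0 x * pt (t - s) x y))%:E.
  move=> s0 st.
  pose tt i := match i with 0%N => 0 | 1%N => s | _ => t end.
  pose xx i := match i with 0%N => x0 | 1%N => x | _ => y end.
  have := law 2%N tt xx erefl; rewrite !big_ord_recl big_ord0 /= mulr1 subr0 => <-.
    congr (Q _); apply/seteqP; split => v /=.
      by move=> /andP[/andP[/eqP h0 /eqP h1] /eqP h2] [|[|[|i]]].
    move=> h; have /= -> := h 0%N isT; have /= -> := h 1%N isT.
    by have /= -> := h 2%N isT; rewrite !eqxx.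
  by move=> [|[|i]] //=.
have S0 := card_state_gt0.
have SR0 : #|S|%:R != 0 :> R by rewrite pnatr_eq0 -lt0n.
have SRi0 : 0 < #|S|%:R^-1 :> R by rewrite invr_gt0 ltr0n.
have me s t x0 x y : 0 <= s -> s <= t ->
    measurable [set v | (X 0 v == x0) && (X s v == x) && (X t v == y)].
  move=> s0 st; have := measurableI _ _ (measurableI _ _ (process_event x0 (lexx 0))
    (process_event x s0)) (process_event y (le_trans s0 st)).
  by congr measurable; apply/seteqP; split => v /=;
    [move=> [[-> ->] ->]|move=> /andP[/andP[-> ->] ->]].
(* In the joint law at 0, [t] and [t], the last factor [pt 0 y y] is 1, so [pt t x y] is a
   probability up to the uniform weight. *)
have pos t x y : 0 <= t -> 0 <= pt t x y.
  move=> t0; have := joint t t x y y t0 (lexx t).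
  rewrite subrr pt0 eqxx mulr1 => E.
  by rewrite -(pmulr_rge0 _ SRi0) -lee_fin -E.
pose J s t x0 x y v : R := ((X 0 v == x0) && (X s v == x) && (X t v == y))%:R.
have EJ s t x0 x y : 0 <= s -> s <= t ->
    Ex Q (J s t x0 x y) = #|S|%:R^-1 * (pt s x0 x * pt (t - s) x y).
  by move=> s0 st; rewrite /J Ex_event ?joint//; exact: me.
have bJ s t x0 x y : 0 <= s -> s <= t -> bounded_measurable (J s t x0 x y).
  by move=> s0 st; apply: bm_event; exact: me.
have one t x : 0 <= t -> \sum_y pt t x y = 1.
  move=> t0; apply: (mulfI (lt0r_neq0 SRi0)).
  transitivity (Ex Q (J 0 0 x x x)); last first.
    by rewrite EJ// subrr pt0 eqxx !mulr1.
  transitivity (\sum_y Ex Q (J t t x y y)).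
    rewrite mulr_sumr; apply: eq_bigr => y _.
    by rewrite EJ// subrr pt0 eqxx mulr1.
  rewrite -Ex_sum => [|y]; last exact: bJ.
  congr Ex; apply/funext => v; rewrite /J (bigD1 (X t v))//= !eqxx !andbT !andbb.
  by rewrite big1 ?addr0// => y; rewrite eq_sym => /negbTE->; rewrite andbF.
exists pt; split=> // s t f g s0 st.
have -> : (fun v => f (X s v) * g (X t v)) =
    fun v => \sum_x0 \sum_x \sum_y (f x * g y) * J s t x0 x y v.
  apply/funext => v; rewrite (bigD1 (X 0 v))//= [X in _ + X]big1 => [|x0].
    rewrite addr0 (bigD1 (X s v))//= [X in _ + X]big1 => [|x].
      rewrite addr0 (bigD1 (X t v))//= [X in _ + X]big1 => [|y].
        by rewrite addr0 /J !eqxx mulr1.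
      by rewrite /J [_ == y]eq_sym => /negbTE->; rewrite andbF mulr0.
    rewrite /J [x == _]eq_sym => /negbTE->; rewrite andbF big1// => y _.
    by rewrite mulr0.
  rewrite /J [x0 == _]eq_sym => /negbTE->; rewrite big1// => x _.
  by rewrite big1// => y _; rewrite mulr0.
rewrite Ex_sum => [|x0]; last first.
  by apply: bm_sum => x; apply: bm_sum => y; apply: bmZ; exact: bJ.
rewrite /mean mulr_sumr; apply: eq_bigr => x0 _.
rewrite Ex_sum => [|x]; last by apply: bm_sum => y; apply: bmZ; exact: bJ.
rewrite /avg mulr_sumr; apply: eq_bigr => x _.
rewrite Ex_sum => [|y]; last by apply: bmZ; exact: bJ.
rewrite !mulr_sumr; apply: eq_bigr => y _.
by rewrite ExZ ?EJ//; [ring|exact: bJ].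
Qed.

End Process.

(** * Occupation times as limits of Riemann sums *)

Section Riemann.
Context {R : realType} {S : finType}.

(* Right endpoints, since the paths are only assumed right-continuous. *)
Definition riemann_sum (T : R) (n : nat) (f : R -> R) : R :=
  n.+1%:R^-1 * \sum_(k < n.+1) f (k.+1%:R * (T / n.+1%:R)).

Lemma cvg_riemann_sum (T : R) (x : R -> S) (b : S -> bool) :
  0 < T -> cadlag_path x ->
  (fun n => riemann_sum T n (fun s => (b (x s))%:R)) @ \oo -->
  T^-1 * \int[lebesgue_measure]_(s in `[0, T]) (b (x s))%:R.
Proof.
move=> T0 [rc _]; pose f s : R := (b (x s))%:R.
have f0 s : 0 <= f s by exact: ler0n.
have f1 s : f s <= 1 by rewrite /f; case: (b _).
pose h n : R := T / n.+1%:R.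
have h0 n : 0 < h n by rewrite divr_gt0.
have nh n : n.+1%:R * h n = T by rewrite /h mulrC divfK.
pose I n (k : nat) : set R := `[k%:R * h n, k.+1%:R * h n[%classic.
pose F n s : R := \sum_(k < n.+1) f (k.+1%:R * h n) * \1_(I n k) s.
have FE n s : 0 <= s < T ->
    exists2 k : 'I_n.+1, F n s = f (k.+1%:R * h n) &
      k%:R * h n <= s < k.+1%:R * h n.
  move=> /andP[s0 sT].
  have sh0 : 0 <= s / h n by rewrite divr_ge0// ltW.
  have /andP[k1 k2] := truncn_itv sh0.
  rewrite ler_pdivlMr// in k1; rewrite ltr_pdivrMr// in k2.
  have kn : (Num.truncn (s / h n) < n.+1)%N.
    by rewrite -(ltr_nat R) -(ltr_pM2r (h0 n)) nh (le_lt_trans k1).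
  exists (Ordinal kn) => /=; last by rewrite k1.
  rewrite /F (bigD1 (Ordinal kn))//= indicE mem_set ?mulr1; last first.
    by rewrite /I /= in_itv /= k1.
  rewrite big1 ?addr0// => j jk; rewrite indicE memNset ?mulr0//.
  rewrite /I /= in_itv /= => /andP[j1 j2]; move/eqP: jk; apply.
  apply/val_inj => /=; apply/eqP; rewrite eqn_leq; apply/andP; split.
    by rewrite -ltnS -(ltr_nat R) -(ltr_pM2r (h0 n)) (le_lt_trans j1).
  by rewrite -ltnS -(ltr_nat R) -(ltr_pM2r (h0 n)) (le_lt_trans k1).
have mI n k : measurable (I n k) by exact: measurable_itv.
have mterm n k : measurable_fun `[0, T[%classic
    (fun s => (f (k.+1%:R * h n))%:E * (\1_(I n k) s)%:E)%E.
  apply/measurable_EFinP; apply: measurable_funM => //; exact: measurable_indic.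
have FEE n s : (F n s)%:E =
    (\sum_(k < n.+1) (f (k.+1%:R * h n))%:E * (\1_(I n k) s)%:E)%E.
  by rewrite /F -sumEFin; apply: eq_bigr => k _; rewrite EFinM.
have mF n : measurable_fun `[0, T[%classic (fun s => (F n s)%:E).
  by rewrite (funext (FEE n)); exact: emeasurable_sum.
have cvgF s : `[0, T[%classic s -> (fun n => (F n s)%:E) @ \oo --> (f s)%:E.
  rewrite /= in_itv /= => sT; have /andP[s0 _] := sT.
  have [e e0 xe] := rc s s0.
  apply: cvg_near_cst; near=> n.
  have [k -> /andP[k1 k2]] := FE n s sT.
  congr EFin; rewrite /f xe// ltW//= -natr1 mulrDl mul1r ler_ltD//.
  rewrite /h ltr_pdivrMr// -ltr_pdivrMl//.
  apply: lt_trans (_ : n%:R < _); last by rewrite ltr_nat.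
  by near: n; exact: nbhs_infty_gtr.
(* Measurability of the path functional is itself obtained from the step functions, as their
   pointwise limit. *)
have mf : measurable_fun `[0, T[%classic (fun s => (f s)%:E).
  exact: emeasurable_fun_cvg mF cvgF.
have int1 : lebesgue_measure.-integrable `[0, T[%classic (EFin \o cst (1:R)).
  apply: measurable_bounded_integrable => //.
    by rewrite /= lebesgue_measure_itv /=; case: ifPn => // _; rewrite -EFinB ltry.
  exists 1; split; first exact: num_real.
  by move=> M M1 s _ /=; rewrite normr1 ltW.
pose I0 : set R := `[0, T[%classic.
have mind n k : measurable_fun I0 (fun s => (\1_(I n k) s)%:E).
  by apply/measurable_EFinP; exact: measurable_indic.
have intF n : (\int[lebesgue_measure]_(s in I0) (F n s)%:E)%E =
    (T * riemann_sum T n f)%:E.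
  rewrite (funext (FEE n)).
  rewrite ge0_integral_sum; [|exact: measurable_itv|by move=> k; exact: mterm|
    by move=> k s _; rewrite mule_ge0// lee_fin].
  have -> : T * riemann_sum T n f = \sum_(k < n.+1) f (k.+1%:R * h n) * h n.
    by rewrite /riemann_sum mulrA -mulr_suml mulrC.
  rewrite -sumEFin; apply: eq_bigr => k _.
  rewrite ge0_integralZl_EFin; [|exact: measurable_itv|
    by move=> s _; rewrite lee_fin|
    exact: mind|exact: f0].
  rewrite integral_indic; [|exact: measurable_itv|exact: mI].
  rewrite EFinM; congr (_ * _)%E.
  have <- : lebesgue_measure (I n k) = (h n)%:E.
    rewrite /I lebesgue_measure_itv /= lte_fin ltr_pM2r// ltr_nat ltnSn.
    by rewrite -EFinD -natr1; congr EFin; ring.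
  congr (lebesgue_measure _).
  apply/setIidPl => s; rewrite /I /I0 /= !in_itv /= => /andP[s1 s2]; apply/andP; split.
    by rewrite (le_trans _ s1)// mulr_ge0// ltW.
  by rewrite (lt_le_trans s2)// -(nh n) ler_pM2r// ler_nat.
have := @dominated_cvg _ _ R lebesgue_measure `[0, T[%classic (measurable_itv _)
  (fun n s => (F n s)%:E) (fun s => (f s)%:E) (EFin \o cst 1) mF cvgF
  (fun s _ => isT) int1.
have FB n s : `[0, T[%classic s -> (`|(F n s)%:E| <= (EFin \o cst 1%R) s)%E.
  rewrite /= in_itv /= => sT; have [k -> _] := FE n s sT.
  by rewrite lee_fin ger0_norm.
move=> /(_ FB).
pose I1 : set R := `[0, T]%classic.
have -> : (\int[lebesgue_measure]_(s in `[0%R, T[) (f s)%:E)%E =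
   (\int[lebesgue_measure]_(s in I1) (f s)%:E)%E.
  exact: integral_itv_bndo_bndc.
under eq_cvg do rewrite intF.
have If : (\int[lebesgue_measure]_(s in I1) (f s)%:E)%E \is a fin_num.
  rewrite -integral_itv_bndo_bndc//; apply: integrable_fin_num => //.
  apply: le_integrable int1 => // s _ /=.
  by rewrite lee_fin normr1 ger0_norm.
rewrite -(fineK If) => /fine_cvg h1.
have -> : (fun n => riemann_sum T n (fun s => (b (x s))%:R)) =
   (fun n => T^-1 * (T * riemann_sum T n f)).
  by apply/funext => n; rewrite mulrA mulVf ?mul1r// gt_eqF.
exact: cvgMr.
Unshelve. all: by end_near.
Qed.

End Riemann.

Lemma cvgr_sum (R : realType) (I : eqType) (s : seq I) (F : I -> nat -> R) (l : I -> R) :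
  {in s, forall i, F i @ \oo --> l i} ->
  (fun n => \sum_(i <- s) F i n) @ \oo --> \sum_(i <- s) l i.
Proof.
elim: s => [|i s IH] Fl.
  by rewrite big_nil; under eq_fun do rewrite big_nil; exact: cvg_cst.
rewrite big_cons; under eq_fun do rewrite big_cons.
apply: cvgD; first by apply: Fl; rewrite mem_head.
by apply: IH => j js; apply: Fl; rewrite inE js orbT.
Qed.

(** * Mean error of occupation fractions in a reversible process *)

Section OccupationBound.
Context {R : realType} {S : finType} {d : measure_display} {D : measurableType d}.
Variables (Q : probability D R) (r : S -> S -> R) (X : R -> D -> S).
Hypothesis mp : markov_jump_process Q r X.
Variables (T : R) (c : S -> S -> R) (gam : S -> R).
Hypotheses (T0 : 0 < T) (nc : network c) (gam0 : forall x, 0 < gam x).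
Hypothesis rc : forall x y, x != y -> T * r x y = c x y / gam x.

Lemma generator_lap f x :
  - (T * \sum_y generator r x y * f y) = lap c f x / gam x.
Proof.
have -> : lap c f x = \sum_(y | y != x) c x y * (f x - f y).
  by rewrite /lap (bigD1 x)//= subrr mulr0 add0r.
rewrite (bigD1 x)//= /generator eqxx.
have -> : \sum_(y | y != x) (if x == y then
      - \sum_(z | z != x) r x z else r x y) * f y =
    \sum_(y | y != x) r x y * f y.
  by apply: eq_bigr => y; rewrite eq_sym => /negbTE->.
set A := \sum_(z | z != x) r x z; set B := \sum_(y | y != x) _ * _.
have -> : - (T * (- A * f x + B)) = A * (T * f x) - T * B by ring.
rewrite mulr_suml mulr_sumr -sumrB mulr_suml; apply: eq_bigr => y yx.
have -> : r x y * (T * f x) - T * (r x y * f y) = T * r x y * (f x - f y) by ring.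
by rewrite rc 1?eq_sym//; ring.
Qed.

(** Differentiability of the semigroup at 0, along the steps [T / n.+1]; uniformity in [x] is free
    on a finite set. *)
Lemma generator_approx pt f (e : R) :
  markov_semigroup pt ->
  (forall x y, (fun h => (pt h x y - pt 0 x y) / h) @ 0^'+ --> generator r x y) ->
  0 < e ->
  \forall n \near \oo, forall x,
    `|n.+1%:R * (f x - avg pt (T / n.+1%:R) f x) - lap c f x / gam x| <= e.
Proof.
move=> sg gen e0; apply: filter_forall => x.
have [pt0 _ _ _] := sg.
pose h n : R := T / n.+1%:R.
have h0 n : 0 < h n by rewrite divr_gt0.
have h_cvg : h @ \oo --> (0 : R).
  by rewrite -[X in _ --> X](mulr0 T); apply: cvgMr; exact: cvg_harmonic.
have : (fun n => - (T * \sum_y ((pt (h n) x y - pt 0 x y) / h n) * f y)) @ \oo -->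
    - (T * \sum_y generator r x y * f y).
  apply: cvgN; apply: cvgMr; apply: cvgr_sum => y _; apply: cvgMl.
  by have /cvg_at_rightP := gen x y; apply.
rewrite generator_lap => /cvgr_distC_le /(_ e e0).
apply: filterS => n; congr (_ <= _); congr `|_ - _|.
have hE : T / h n = n.+1%:R by rewrite /h invf_div mulrC divfK ?gt_eqF.
have -> : \sum_y (pt (h n) x y - pt 0 x y) / h n * f y =
    (avg pt (h n) f x - f x) / h n.
  rewrite -[X in _ - X](avg0 sg) /avg -sumrB mulr_suml; apply: eq_bigr => y _.
  by ring.
by rewrite -/(h n) -hE; ring.
Qed.

Definition path_avg n f v : R := riemann_sum T n (fun s => f (X s v)).

Let step n : R := T / n.+1%:R.
Let step_ge0 n : 0 <= step n. Proof. by rewrite divr_ge0// ltW. Qed.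
Let time_ge0 n k : 0 <= k%:R * step n. Proof. by rewrite mulr_ge0. Qed.

Lemma bm_path_avg n f : bounded_measurable (path_avg n f).
Proof.
apply: bmZ; apply: bm_sum => k; apply: (bm_process mp); exact: time_ge0.
Qed.

Lemma path_avgE n f v :
  path_avg n f v = \sum_x path_avg n (fun y => (y == x)%:R) v * f x.
Proof.
rewrite /path_avg /riemann_sum.
under [RHS]eq_bigr do rewrite -mulrA mulr_suml.
rewrite -mulr_sumr exchange_big; congr (_ * _); apply: eq_bigr => k _.
rewrite (bigD1 (X (k.+1%:R * (T / n.+1%:R)) v))//= eqxx mul1r big1 ?addr0// => y.
by rewrite eq_sym => /negbTE->; rewrite mul0r.
Qed.

Lemma path_avg_ge0 n f v : (forall x, 0 <= f x) -> 0 <= path_avg n f v.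
Proof. by move=> f0; rewrite mulr_ge0 ?invr_ge0// sumr_ge0. Qed.

Lemma path_avg1 n v : path_avg n (fun=> 1) v = 1.
Proof. by rewrite /path_avg /riemann_sum sumr_const card_ord mulVf ?pnatr_eq0. Qed.

Let card_gt0 : (0 < #|S|)%N := card_state_gt0 Q X.

(** [occupation_algebra] reduces the claim to two estimates. Occupation of the complement of [A] is
    controlled by the killed potential [psi]; for each [j] in [A], the second moment of the path
    average of the dipole [g j] is controlled by its potential [f j]. *)
Lemma path_avg_bound (A B : {set S}) (l : S) (b : S -> bool) (rho k kap : R) :
  l \in A -> {in A, forall x, b x = (x == l)} ->
  0 <= rho -> {in A, forall x, grounded c rho x} -> 0 < k -> 0 < kap ->
  forall e : R, 0 < e -> \forall n \near \oo,
  Ex Q (fun v => `|path_avg n (fun x => (b x)%:R) v - gam l / \sum_(x in A) gam x|)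
  <= 2 * (expR 2 * (#|B|%:R / #|S|%:R + (2 / gam l + rho) / k +
      k * (\sum_(x in B) \sum_y c x y) + k * (\sum_(x in ~: A :\: B) gam x) + 2 * e)) +
     \sum_(j in A) gam j * (kap + kap^-1 *
       (2 * ((gam l)^-1 + (gam j)^-1) * (8 * rho + e))).
Proof.
move=> lA bA rho0 gr k0 kap0 e e0.
have [pt [sg gen law]] := process_semigroup mp.
have [psi psiE] := resolvent_exists (fun x => gam x * (x \in ~: A)%:R) nc gam0.
pose g j x : R := (x == l)%:R / gam l - (x == j)%:R / gam j.
have [f fE] : exists f : S -> S -> R, forall j x,
    gam x * f j x + lap c (f j) x = (x == l)%:R - (x == j)%:R.
  have F j := resolvent_exists (fun x => (x == l)%:R - (x == j)%:R) nc gam0.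
  by exists (fun j => projT1 (cid (F j))) => j x; exact: projT2 (cid (F j)) x.
have lapg j x : lap c (f j) x / gam x = g j x - f j x.
  have -> : lap c (f j) x = (x == l)%:R - (x == j)%:R - gam x * f j x.
    by rewrite -fE addrC addKr.
  rewrite mulrBl [gam x * _]mulrC mulfK ?gt_eqF//; congr (_ - _).
  by rewrite mulrBl /g; congr (_ - _); have [->//|_] := eqVneq; rewrite !mul0r.
have lappsi x : lap c psi x / gam x = (x \in ~: A)%:R - psi x.
  have -> : lap c psi x = gam x * (x \in ~: A)%:R - gam x * psi x.
    by rewrite -psiE addrC addKr.
  by rewrite -mulrBr mulrC mulKf ?gt_eqF.
have psi0 x : 0 <= psi x.
  by apply: (minimum_principle nc gam0) => y; rewrite psiE mulr_ge0// ltW.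
have psi_mean := killed_occupation B nc gam0 rho0 (gr l lA) k0 psiE.
near=> n.
have psi_step x : `|n.+1%:R * (psi x - avg pt (step n) psi x) -
     ((x \in ~: A)%:R - psi x)| <= e.
  rewrite -lappsi; move: x; near: n; exact: generator_approx.
have f_step j x : `|n.+1%:R * (f j x - avg pt (step n) (f j) x) -
     (g j x - f j x)| <= e.
  rewrite -lapg; move: j x; near: n.
  by apply: filter_forall => j; exact: generator_approx.
pose o v x := path_avg n (fun y => (y == x)%:R) v.
have oA v (C : {set S}) : path_avg n (fun x => (x \in C)%:R) v = \sum_(x in C) o v x.
  rewrite path_avgE [RHS]big_mkcond; apply: eq_bigr => x _.
  by case: (x \in C); rewrite ?mulr1 ?mulr0.
have og j v : o v l / gam l - o v j / gam j = path_avg n (g j) v.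
  rewrite /o /path_avg /riemann_sum -!mulrA !mulr_suml -mulrBr -sumrB.
  by congr (_ * _); apply: eq_bigr => k' _.
have Eo : Ex Q (path_avg n (fun x => (x \in ~: A)%:R)) <= expR 2 * (mean psi + 2 * e).
  have bA' k' := bm_process mp (fun x => (x \in ~: A)%:R) (time_ge0 n k').
  rewrite /path_avg /riemann_sum ExZ; last by apply: bm_sum => k'; exact: bA'.
  rewrite Ex_sum; last by move=> k'; exact: bA'.
  apply: le_trans (skeleton_occupation sg card_gt0 (ltn0Sn n) (step_ge0 n)
    (ltW e0) psi0 psi_step).
  rewrite ler_wpM2l ?invr_ge0//; apply: ler_sum => k' _.
  have := law _ _ (fun x => (x \in ~: A)%:R) (fun=> 1) (time_ge0 n k'.+1) (lexx _).
  under eq_fun do rewrite mulr1.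
  move=> ->; rewrite le_eqVlt; apply/orP; left; apply/eqP; congr (_ * _).
  apply: eq_bigr => x _; congr avg; apply/funext => y.
  by rewrite subrr (avg_cst sg)// mulr1.
have Eg j : j \in A -> Ex Q (fun v => path_avg n (g j) v ^+ 2) <=
    2 * ((gam l)^-1 + (gam j)^-1) * (8 * rho + e).
  move=> jA.
  have [fj0 fl0 _ flj] := dipole_range l nc gam0 rho0 (gr l lA) (gr j jA) (fE j).
  have range x := dipole_range x nc gam0 rho0 (gr l lA) (gr j jA) (fE j).
  pose a : R := (gam l)^-1 + (gam j)^-1.
  have ga x : `|g j x| <= a.
    rewrite (le_trans (ler_normB _ _))// lerD// normrM [`|_^-1|]gtr0_norm ?invr_gt0//.
      by case: (x == l); rewrite ?normr1 ?mul1r// normr0 mul0r invr_ge0 ltW.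
    by case: (x == j); rewrite ?normr1 ?mul1r// normr0 mul0r invr_ge0 ltW.
  have fr x : `|f j x| <= 4 * rho.
    have [_ _ /andP[h1 h2] _] := range x.
    by rewrite ler_norml; apply/andP; split; lra.
  have fosc x y : `|f j x - f j y| <= 4 * rho.
    have [_ _ /andP[h1 h2] _] := range x; have [_ _ /andP[h3 h4] _] := range y.
    by rewrite ler_norml; apply/andP; split; lra.
  pose corr k' := n.+1%:R^-1 * (\sum_(i < n.+1 - k')
     mean (avg pt (k'.+1%:R * step n) (fun x => g j x * avg pt (i%:R * step n) (g j) x))).
  have corr_le k' : (k' <= n.+1)%N -> corr k' <= a * (2 * (4 * rho) + e).
    move=> kn; exact: (skeleton_correlation sg card_gt0 (ltn0Sn n) (step_ge0 n)
      (ltW e0) fr fosc ga (f_step j) kn).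
  pose G k' v := g j (X (k'.+1%:R * step n) v).
  have bG k' : bounded_measurable (G k').
    have h := bm_process mp (g j) (time_ge0 n k'.+1). exact h.
  (* The square is expanded over time-ordered pairs, so that the Markov property at the earlier time
     produces the sums [corr k']. *)
  apply: (@le_trans _ _ (Ex Q (fun v => 2 * n.+1%:R^-1 ^+ 2 *
     \sum_(k' < n.+1) \sum_(i < n.+1 - k') G k' v * G (k' + i)%N v))).
    apply: Ex_le.
    - by under eq_fun do rewrite expr2; apply: bmM; exact: bm_path_avg.
    - by apply: bmZ; apply: bm_sum => k'; apply: bm_sum => i; exact: bmM.
    move=> v /=; have H := sqr_sum_le n.+1 (fun k' => G k' v).
    have -> : path_avg n (g j) v = n.+1%:R^-1 * \sum_(k' < n.+1) G k' v by [].
    by rewrite exprMn [leRHS]mulrAC [leRHS]mulrC ler_wpM2l// sqr_ge0.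
  rewrite ExZ; last by apply: bm_sum => k'; apply: bm_sum => i; exact: bmM.
  rewrite Ex_sum; last by move=> k'; apply: bm_sum => i; exact: bmM.
  have -> : \sum_(k' < n.+1) Ex Q (fun v => \sum_(i < n.+1 - k') G k' v * G (k' + i)%N v) =
     n.+1%:R * \sum_(k' < n.+1) corr k'.
    rewrite mulr_sumr; apply: eq_bigr => k' _.
    rewrite Ex_sum; last by move=> i; exact: bmM.
    rewrite /corr mulrA mulfV ?mul1r ?pnatr_eq0//; apply: eq_bigr => i _.
    rewrite /G law//; last by rewrite ler_wpM2r// ler_nat ltnS leq_addr.
    have -> // : (k' + i).+1%:R * step n - k'.+1%:R * step n = i%:R * step n.
    by rewrite -mulrBl -addSn natrD addrC addKr.
  have -> : 2 * n.+1%:R^-1 ^+ 2 * (n.+1%:R * \sum_(k' < n.+1) corr k') =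
     2 * (n.+1%:R^-1 * \sum_(k' < n.+1) corr k').
    by field; rewrite nat1r pnatr_eq0.
  rewrite -mulrA ler_wpM2l// mulrC ler_pdivrMr//.
  have -> : a * (8 * rho + e) * n.+1%:R = \sum_(k' < n.+1) (a * (2 * (4 * rho) + e)).
    by rewrite sumr_const card_ord -[RHS]mulr_natr; congr (_ * _ * _); ring.
  by apply: ler_sum => k' _; apply: corr_le; rewrite ltnW.
set pi := gam l / _.
(* A first moment is traded for a second one by [|z| <= kap + z ^+ 2 / kap]. *)
pose Z v := 2 * path_avg n (fun x => (x \in ~: A)%:R) v +
   \sum_(j <- enum A) gam j * (kap + kap^-1 * path_avg n (g j) v ^+ 2).
have bZj j : bounded_measurable (fun v => gam j * (kap + kap^-1 * path_avg n (g j) v ^+ 2)).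
  apply: bmZ; apply: bmD; first exact: bm_cst.
  by apply: bmZ; under eq_fun do rewrite expr2; apply: bmM; exact: bm_path_avg.
have bZ : bounded_measurable Z.
  by apply: bmD; [apply: bmZ; exact: bm_path_avg|exact: bm_sum].
apply: (@le_trans _ _ (Ex Q Z)).
  apply: Ex_le => //.
    by apply: bm_norm; apply: bmB; [exact: bm_path_avg|exact: bm_cst].
  move=> v; rewrite path_avgE.
  apply: le_trans (occupation_algebra (o := o v) _ _ gam0 lA bA) _.
  - by move=> x; apply: path_avg_ge0 => y; exact: ler0n.
  - by rewrite -(path_avg1 n v) path_avgE; apply: eq_bigr => x _; rewrite mulr1.
  rewrite /Z oA lerD2l big_enum /=; apply: ler_sum => j _.
  rewrite ler_wpM2l ?(ltW (gam0 _))// og; set z := path_avg _ _ _.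
  rewrite -[z ^+ 2]real_normK ?num_real//; set y := `|z|.
  have y0 : 0 <= y by exact: normr_ge0.
  have [yk|ky] := lerP y kap.
    by rewrite (le_trans yk)// lerDl mulr_ge0 ?invr_ge0 ?sqr_ge0// ltW.
  rewrite -[leLHS]add0r lerD ?(ltW kap0)// mulrC ler_pdivlMr// expr2.
  by rewrite ler_wpM2l// ltW.
rewrite /Z ExD; [|by apply: bmZ; exact: bm_path_avg|exact: bm_sum].
rewrite ExZ; last exact: bm_path_avg.
rewrite Ex_sum// big_enum /= lerD//.
  rewrite ler_wpM2l// (le_trans Eo)// ler_wpM2l ?expR_ge0// lerD2r.
  exact: psi_mean.
apply: ler_sum => j jA; rewrite ExZ; last first.
  apply: bmD; first exact: bm_cst.
  by apply: bmZ; under eq_fun do rewrite expr2; apply: bmM; exact: bm_path_avg.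
rewrite ler_wpM2l ?(ltW (gam0 _))// ExD; last 2 first.
- exact: bm_cst.
- by apply: bmZ; under eq_fun do rewrite expr2; apply: bmM; exact: bm_path_avg.
rewrite Ex_cst lerD2l ExZ; last first.
  by under eq_fun do rewrite expr2; apply: bmM; exact: bm_path_avg.
by rewrite ler_wpM2l ?invr_ge0 ?(ltW kap0)// Eg.
Unshelve. all: by end_near.
Qed.

Lemma path_avg_norm n (b : S -> bool) v : `|path_avg n (fun x => (b x)%:R) v| <= 1.
Proof.
rewrite ger0_norm; last by apply: path_avg_ge0 => x; exact: ler0n.
rewrite -[leRHS](path_avg1 n v) ler_wpM2l ?invr_ge0//; apply: ler_sum => k _.
by case: (b _).
Qed.

(** The limit [n -> oo] of [path_avg_bound]: Riemann sums converge along each path, expectations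
    follow by dominated convergence, and the generator error is then sent to 0. *)
Lemma occupation_bound (A B : {set S}) (l : S) (b : S -> bool) (rho k kap : R)
    (Y := fun v => T^-1 * \int[lebesgue_measure]_(s in `[0, T]) (b (X s v))%:R) :
  l \in A -> {in A, forall x, b x = (x == l)} ->
  0 <= rho -> {in A, forall x, grounded c rho x} -> 0 < k -> 0 < kap ->
  bounded_measurable Y /\
  Ex Q (fun v => `|Y v - gam l / \sum_(x in A) gam x|)
  <= 2 * (expR 2 * (#|B|%:R / #|S|%:R + (2 / gam l + rho) / k +
      k * (\sum_(x in B) \sum_y c x y) + k * (\sum_(x in ~: A :\: B) gam x))) +
     \sum_(j in A) gam j * (kap + kap^-1 *
       (2 * ((gam l)^-1 + (gam j)^-1) * (8 * rho))).
Proof.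
move=> lA bA rho0 gr k0 kap0.
pose Z n v := path_avg n (fun x => (b x)%:R) v.
have [_ cad _] := mp.
have ZY v : Z ^~ v @ \oo --> Y v by exact: cvg_riemann_sum.
have bY : bounded_measurable Y.
  split.
    apply: (measurable_fun_cvg (h := Z)) => [n|v _]; last exact: ZY.
    by have [] := bm_path_avg n (fun x => (b x)%:R).
  exists 1 => v; apply: (cvgr_to_le (cvg_norm (ZY v))).
  by near=> n; exact: path_avg_norm.
split=> //.
set pi := gam l / _.
have lim : (fun n => Ex Q (fun v => `|Z n v - pi|)) @ \oo --> Ex Q (fun v => `|Y v - pi|).
  have bm n : bounded_measurable (fun v => `|Z n v - pi|).
    by apply: bm_norm; apply: bmB; [exact: bm_path_avg|exact: bm_cst].
  have bmY : bounded_measurable (fun v => `|Y v - pi|).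
    by apply: bm_norm; apply: bmB => //; exact: bm_cst.
  have intC : Q.-integrable setT (EFin \o cst (1 + `|pi|)).
    exact: bm_integrable (bm_cst _).
  have := @dominated_cvg _ _ R Q setT measurableT
    (fun n v => (`|Z n v - pi|)%:E) (fun v => (`|Y v - pi|)%:E) (EFin \o cst (1 + `|pi|)).
  have mZ n : measurable_fun setT (fun v => (`|Z n v - pi|)%:E).
    by apply/measurable_EFinP; have [] := bm n.
  move=> /(_ mZ); move=> H.
  have {}H : (\int[Q]_v (`|Z n v - pi|)%:E)%E @[n --> \oo] --> (\int[Q]_v (`|Y v - pi|)%:E)%E.
    apply: H => //.
    - move=> v _; apply: cvg_EFin; first by near=> n.
      by apply: cvg_norm; apply: cvgB; [exact: ZY|exact: cvg_cst].
    - move=> n v _ /=; rewrite lee_fin normr_id (le_trans (ler_normB _ _))// lerD2r.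
      exact: path_avg_norm.
  have fin : (\int[Q]_v (`|Y v - pi|)%:E)%E \is a fin_num.
    by apply: integrable_fin_num => //; exact: bm_integrable bmY.
  by move: H; rewrite -(fineK fin) => /fine_cvg.
set C1 := _ / _ + _ + _ + _; set a := fun j => (gam l)^-1 + (gam j)^-1.
(* The coefficient of the generator error in [path_avg_bound]; taking that error equal to [e / C]
   costs exactly [e]. *)
pose C := 4 * expR 2 + \sum_(j in A) gam j * (kap^-1 * (2 * a j)).
have C0 : 0 < C.
  rewrite ltr_pwDl ?mulr_gt0 ?expR_gt0// sumr_ge0// => j _.
  rewrite mulr_ge0 ?(ltW (gam0 _))// mulr_ge0 ?invr_ge0 ?(ltW kap0)//.
  by rewrite mulr_ge0// addr_ge0 ?invr_ge0 ?ltW.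
apply/ler_addgt0Pr => e e0.
apply: (cvgr_to_le lim).
have eC0 : 0 < e / C by exact: divr_gt0.
apply: filterS (path_avg_bound B lA bA rho0 gr k0 kap0 eC0) => n.
move=> /le_trans; apply.
have eE : e = e / C * C by rewrite divfK// gt_eqF.
rewrite le_eqVlt; apply/orP; left; apply/eqP; rewrite [in RHS]eE.
move: (e / C) => E; rewrite /C.
have -> : \sum_(j in A) gam j * (kap + kap^-1 * (2 * (a j) * (8 * rho + E))) =
   \sum_(j in A) gam j * (kap + kap^-1 * (2 * (a j) * (8 * rho))) +
   E * \sum_(j in A) gam j * (kap^-1 * (2 * a j)).
  by rewrite mulr_sumr -big_split /=; apply: eq_bigr => j _; ring.
by rewrite /C1; ring.
Unshelve. all: by end_near.
Qed.

End OccupationBound.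

(** * The two-level hypercube *)

Lemma mean_norm_le (R : realType) (S : finType) (h : S -> R) (e : R) :
  0 <= e -> (forall x, `|h x| <= e) -> `|mean h| <= e.
Proof.
move=> e0 he; rewrite /mean normrM ger0_norm ?invr_ge0// mulrC.
have [S0|S0] := posnP #|S|; first by rewrite S0 invr0 mulr0.
rewrite ler_pdivrMr ?ltr0n//.
rewrite (le_trans (ler_norm_sum _ _ _))// mulr_natr -sumr_const.
exact: ler_sum.
Qed.

Lemma sqr_mean_le (R : realType) (S : finType) (h : S -> R) :
  mean h ^+ 2 <= mean (fun x => h x ^+ 2).
Proof.
have [S0|S0] := posnP #|S|.
  by rewrite /mean S0 invr0 !mul0r expr0n.
have : 0 <= mean (fun x => (h x - mean h) ^+ 2) by apply: mean_ge0 => x; exact: sqr_ge0.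
have -> : (fun x => (h x - mean h) ^+ 2) =
  fun x => (- 2 * mean h) * h x + (1 * h x ^+ 2 + mean h ^+ 2).
  by apply/funext => x; ring.
by rewrite mean_lin (mean_lin 1) mean_cst// expr2; lra.
Qed.

Lemma differ1_sym n (x y : cube n) : differ1 x y = differ1 y x.
Proof. by rewrite /differ1; congr (_ == _); apply: eq_card => i; rewrite !inE eq_sym. Qed.

(** The differing coordinates are flipped one at a time, by induction on the Hamming distance. *)
Lemma cube_path (R : realType) n (F : cube n -> R) (e : R) : 0 <= e ->
  (forall x y, differ1 x y -> `|F x - F y| <= e) ->
  forall x y, `|F x - F y| <= n%:R * e.
Proof.
move=> e0 Fe x y.
suff H k : #|[set i | x i != y i]%SET| = k -> `|F x - F y| <= k%:R * e.
  rewrite (le_trans (H _ erefl))// ler_wpM2r// ler_nat.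
  by rewrite (leq_trans (max_card _))// card_ord.
elim: k x => [|k IH] x.
  move=> /eqP; rewrite cards_eq0 => /eqP E.
  suff -> : x = y by rewrite subrr normr0 mul0r.
  apply/ffunP => i; apply/eqP; apply/negPn/negP => xy.
  have : i \in [set i | x i != y i]%SET by rewrite inE.
  by rewrite E inE.
move=> E; have [i xyi] : exists i, i \in [set i | x i != y i]%SET.
  by apply/card_gt0P; rewrite E.
pose z : cube n := [ffun j => if j == i then y j else x j].
have xz : differ1 x z.
  apply/cards1P; exists i; apply/setP => j; rewrite !inE ffunE.
  by have [->|ji] := eqVneq j i; [move: xyi; rewrite inE|rewrite eqxx].
have zy : #|[set j | z j != y j]%SET| = k.
  have -> : [set j | z j != y j]%SET = ([set j | x j != y j] :\ i)%SET.
    by apply/setP => j; rewrite !inE ffunE; have [->|ji] := eqVneq j i; rewrite ?eqxx.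
  by have := cardsD1 i [set j | x j != y j]%SET; rewrite xyi E => -[->].
have -> : F x - F y = (F x - F z) + (F z - F y) by ring.
rewrite (le_trans (ler_normD _ _))// -natr1 mulrDl mul1r addrC lerD ?Fe//.
exact: IH.
Qed.

Lemma card_differ1 n (x : cube n) : (#|[set y | differ1 x y]%SET| <= n)%N.
Proof.
pose flip (i : 'I_n) : cube n := [ffun j => if j == i then ~~ x j else x j].
apply: leq_trans (_ : #|flip @: [set: 'I_n]%SET| <= n)%N; last first.
  by rewrite (leq_trans (leq_imset_card _ _))// cardsT card_ord.
apply: subset_leq_card; apply/fintype.subsetP => y; rewrite inE => /cards1P [i E].
apply/imsetP; exists i; rewrite ?inE//; apply/ffunP => j; rewrite ffunE.
have := erefl (j \in [set i]%SET); rewrite -{1}E !inE.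
by case: (j == i); case: (x j); case: (y j).
Qed.

Section TwoLevel.
Context {R : realType} {n1 n2 : nat}.
Variables (k : R) (wt : cube n1 -> R) (N : nat).
Hypotheses (k0 : 0 < k) (wt0 : forall s, 0 < wt s).
Hypotheses (n1N : (n1 <= N)%N) (n2N : (n2 <= N)%N).
Local Notation S := (cube n1 * cube n2)%type.

Definition two_level (s s' : S) : R :=
  if differ1 s.1 s'.1 && (s.2 == s'.2) then k
  else if (s.1 == s'.1) && differ1 s.2 s'.2 then k * wt s.1 else 0.

Lemma network_two_level : network two_level.
Proof.
split=> s s'; rewrite /two_level.
  case: ifP => _; first exact: ltW.
  by case: ifP => _ //; rewrite mulr_ge0 ?ltW.
rewrite !(differ1_sym s'.1) !(differ1_sym s'.2) ![s'.2 == _]eq_sym ![s'.1 == _]eq_sym.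
by have [->|_] := eqVneq s.1 s'.1.
Qed.

Lemma sum_two_level (s : S) : \sum_s' two_level s s' <= N%:R * (k * (1 + wt s.1)).
Proof.
have split s' : two_level s s' <= (differ1 s.1 s'.1)%:R * (s.2 == s'.2)%:R * k +
    (s.1 == s'.1)%:R * (differ1 s.2 s'.2)%:R * (k * wt s.1).
  have kw : 0 <= k * wt s.1 by rewrite mulr_ge0 ?ltW.
  have k' := ltW k0.
  rewrite /two_level; case: (differ1 s.1 s'.1); case: (s.2 == s'.2);
  case: (s.1 == s'.1); case: (differ1 s.2 s'.2);
  by rewrite /= ?mulr1 ?mul1r ?mul0r ?mulr0 ?mul0r ?addr0 ?add0r ?lerDl ?lerDr.
apply: le_trans (ler_sum _ (fun s' _ => split s')) _.
have one (T : finType) (z : T) (g : T -> R) : \sum_y (z == y)%:R * g y = g z.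
  rewrite (bigD1 z)//= eqxx mul1r big1 ?addr0// => y; rewrite eq_sym => /negbTE->.
  by rewrite mul0r.
have nb n (z : cube n) : (n <= N)%N -> \sum_y (differ1 z y)%:R <= N%:R :> R.
  move=> nN; rewrite -natr_sum ler_nat (leq_trans _ nN)//.
  rewrite (leq_trans _ (card_differ1 z))// -sum1_card [leqRHS]big_mkcond /=.
  by apply: leq_sum => y _; rewrite inE; case: (differ1 z y).
rewrite big_split /= mulrDr mulr1 mulrDr.
rewrite -(pair_bigA _ (fun x y => (differ1 s.1 x)%:R * (s.2 == y)%:R * k)) /=.
rewrite -(pair_bigA _ (fun x y => (s.1 == x)%:R * (differ1 s.2 y)%:R * (k * wt s.1))) /=.
apply: lerD.
  under eq_bigr do under eq_bigr do rewrite mulrAC mulrC.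
  under eq_bigr do rewrite one.
  by rewrite -mulr_suml ler_wpM2r ?nb ?ltW.
under eq_bigr do rewrite -mulr_suml -mulr_sumr.
by rewrite -mulr_suml one ler_wpM2r ?nb// mulr_ge0// ltW.
Qed.

(** The passage from [s] to the uniform distribution goes through the block averages [F]. Inside a
    block, a path of second-level edges is used. Between blocks, Jensen's inequality exploits the
    [2 ^ n2] parallel copies of each first-level edge. *)
Lemma grounded_two_level (s : S) :
  grounded two_level (4 * N%:R ^+ 2 / k * (2 ^- n2 + (wt s.1)^-1)) s.
Proof.
move=> f; have nc := network_two_level; have [c0 csym] := nc.
set E := energy two_level f.
have E0 : 0 <= E by exact: energy_ge0.
pose F s1 := mean (fun s2 => f (s1, s2)).
have card2 : #|cube n2| = (2 ^ n2)%N by rewrite card_ffun card_bool card_ord.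
have cardp n : (0 < #|cube n|)%N by rewrite card_ffun card_bool expn_gt0.
have meanE : mean f = mean F.
  rewrite /mean card_prod natrM invfM -mulrA; congr (_ * _).
  rewrite -mulr_sumr; congr (_ * _).
  by rewrite pair_bigA; apply: eq_bigr => -[].
have sqr_le (u v : R) : 0 <= v -> u ^+ 2 <= v -> `|u| <= Num.sqrt v.
  by move=> v0 uv; rewrite -sqrtr_sqr ler_sqrt.
(* [A] bounds the squared increment of [f] along a second-level edge of the block, [B] that of [F]
   along a first-level edge. The 2 in [B] undoes the half in [energy], as only one orientation of
   the edges is kept. *)
pose A := E / (k * wt s.1); pose B := 2 * 2 ^- n2 * E / k.
have A0 : 0 <= A by rewrite divr_ge0// mulr_ge0// ltW.
have B0 : 0 <= B by rewrite divr_ge0 ?(ltW k0)// mulr_ge0// mulr_ge0// invr_ge0 exprn_ge0.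
have FA : `|F s.1 - f s| <= N%:R * Num.sqrt A.
  have -> : F s.1 - f s = mean (fun s2 => f (s.1, s2) - f s).
    have -> : (fun s2 => f (s.1, s2) - f s) = fun s2 => 1 * f (s.1, s2) + (- f s).
      by apply/funext => s2; rewrite mul1r.
    by rewrite mean_lin mul1r mean_cst.
  apply: mean_norm_le => [|s2]; first by rewrite mulr_ge0 ?sqrtr_ge0.
  have -> : f s = f (s.1, s.2) by case: (s).
  apply: le_trans (_ : n2%:R * Num.sqrt A <= _); last first.
    by rewrite ler_wpM2r ?sqrtr_ge0// ler_nat.
  apply: (cube_path (F := fun z => f (s.1, z))) => [|x y xy]; first exact: sqrtr_ge0.
  apply: sqr_le => //; rewrite ler_pdivlMr ?mulr_gt0// mulrC.
  have := energy_edge f (s.1, x) (s.1, y) nc.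
  rewrite /two_level /= eqxx xy /=; case: ifP => // /andP[+ _].
  by rewrite /differ1 => /cards1P [i /setP /(_ i)]; rewrite !inE !eqxx.
have FB x y : differ1 x y -> `|F x - F y| <= Num.sqrt B.
  move=> xy; apply: sqr_le => //.
  have -> : F x - F y = mean (fun s2 => f (x, s2) - f (y, s2)).
    by rewrite /F /mean -mulrBr -sumrB.
  apply: le_trans (sqr_mean_le _) _.
  rewrite /mean card2 natrX /B.
  have -> : 2 * 2 ^- n2 * E / k = 2 ^- n2 * (2 * E / k) by ring.
  rewrite ler_wpM2l ?invr_ge0 ?exprn_ge0// ler_pdivlMr// mulr_suml.
  rewrite /E /energy mulrA mulfV// mul1r.
  have -> : \sum_u \sum_y two_level u y * (f u - f y) ^+ 2 =
      \sum_u \sum_v \sum_y two_level (u, v) y * (f (u, v) - f y) ^+ 2.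
    by rewrite [RHS]pair_bigA; apply: eq_bigr => -[].
  rewrite (bigD1 x)//= -[leLHS]addr0 lerD//; last first.
    by do 3 (apply: sumr_ge0 => ? _); rewrite mulr_ge0 ?sqr_ge0.
  apply: ler_sum => s2 _; rewrite (bigD1 (y, s2))//=.
  have -> : two_level (x, s2) (y, s2) = k by rewrite /two_level /= xy eqxx.
  by rewrite mulrC lerDl; apply: sumr_ge0 => ? _; rewrite mulr_ge0 ?sqr_ge0.
have MB : `|mean f - F s.1| <= N%:R * Num.sqrt B.
  have -> : mean f - F s.1 = mean (fun s1 => F s1 - F s.1).
    rewrite meanE; have -> : (fun s1 => F s1 - F s.1) = fun s1 => 1 * F s1 + (- F s.1).
      by apply/funext => s1; rewrite mul1r.
    by rewrite mean_lin mul1r mean_cst.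
  apply: mean_norm_le => [|s1]; first by rewrite mulr_ge0 ?sqrtr_ge0.
  apply: le_trans (_ : n1%:R * Num.sqrt B <= _); last first.
    by rewrite ler_wpM2r ?sqrtr_ge0// ler_nat.
  exact: cube_path (sqrtr_ge0 _) FB _ _.
(* The square of a sum of two terms needs coefficients 2 and 2; that of [A] is rounded up to 4 so
   that both resistances carry the same prefactor. *)
have -> : 4 * N%:R ^+ 2 / k * (2 ^- n2 + (wt s.1)^-1) * E =
    2 * (N%:R ^+ 2 * B) + 4 * (N%:R ^+ 2 * A).
  by rewrite /A /B; field; rewrite !gt_eqF// exprn_gt0.
have hsq (u v : R) : `|u| <= N%:R * Num.sqrt v -> 0 <= v -> u ^+ 2 <= N%:R ^+ 2 * v.
  move=> uv v0; rewrite -[u ^+ 2]real_normK ?num_real//.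
  by rewrite -[v in leRHS]sqr_sqrtr// -exprMn lerXn2r ?nnegrE.
have := hsq _ _ MB B0; have := hsq _ _ FA A0.
have -> : mean f - f s = (mean f - F s.1) + (F s.1 - f s) by ring.
move: (mean f - F s.1) (F s.1 - f s) => u v hv hu.
have := sqr_ge0 (u - v); have : 0 <= N%:R ^+ 2 * A by rewrite mulr_ge0 ?exprn_ge0.
rewrite !expr2 in hu hv *; nra.
Qed.

End TwoLevel.

(** * Almost sure properties of the limit objects *)

Section LimitObjects.
Context {R : realType} {d : measure_display} {T : measurableType d}.
Variable P : probability T R.

Lemma W_law_set1 (p a L : R) : W_law p a [set L] = 0%E.
Proof.
have nu0 : normal_prob 0 (Num.sqrt (1 - a)) [set L] = 0%E :> \bar R.
  have /null_content_dominatesP := @normal_prob_dominates R 0 (Num.sqrt (1 - a)).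
  by apply => //; exact: lebesgue_measure_set1.
rewrite /W_law; case: ifPn => // _.
have -> : normal_prob 0 (Num.sqrt (1 - a)) ([set L] `&` `]-oo, 0[%classic) = 0%E.
  apply/eqP; rewrite eq_le measure_ge0 andbT -nu0 le_measure ?inE//.
  exact: measurableI.
by rewrite /= mul0r.
Qed.

(** The law of each [W i] has no atom. Hence almost surely every rank is either fast, [L < W i], or
    slow, [W i < L]. *)
Lemma ae_W_neq (p a L : R) (xi W : nat -> {RV P >-> R}) :
  limit_objects p a xi W -> {ae P, forall w, forall i, W i w != L}.
Proof.
move=> [_ Wl _ _]; apply: ae_foralln => i.
exists (W i @^-1` [set L]); split => //.
- by have := Wl i [set L] (measurable_set1 _); rewrite W_law_set1.
- by move=> w /= /negP; rewrite negbK => /eqP.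
Qed.

Lemma countingE (B : set nat) :
  counting B = (\sum_(i <oo) (\1_B i)%:E)%E :> \bar R.
Proof.
pose F i : set nat := if i \in B then [set i] else set0.
have -> : B = \bigcup_i F i.
  apply/seteqP; split => i; first by move=> Bi; exists i => //; rewrite /F mem_set.
  by move=> [j _]; rewrite /F; case: ifPn => // /set_mem Bj ->.
rewrite (@measure_bigcup _ _ _ (@counting nat R))//; last first.
  apply/trivIsetP => i j _ _ ij; rewrite /F; case: ifPn => _; rewrite ?set0I//.
  case: ifPn => _; rewrite ?setI0//; apply/seteqP; split=> // x /= [-> ji].
  by rewrite ji eqxx in ij.
rewrite (eq_eseriesl (Q := xpredT)) => [|i]; last by rewrite in_setT.
apply: eq_eseriesr => i _.
rewrite indicE; have -> : (i \in \bigcup_i F i) = (i \in B).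
  apply/idP/idP => [/set_mem [j _]|iB].
    by rewrite /F; case: ifPn => // jB ->.
  by apply: mem_set; exists i => //; rewrite /F iB.
rewrite /F; case: ifPn => _; last exact: measure0.
by rewrite /= /counting asboolT// fset_set1 finmap.cardfs1.
Qed.

(** * Mean number of points of a Poisson process in a set *)

Section Campbell.
Variables (mu : set R -> \bar R) (xi : nat -> {RV P >-> R}).
Hypothesis pp : poisson_point_process mu xi.
Variable A : set R.
Hypotheses (mA : measurable A) (muA : (mu A < +oo)%E) (muA0 : (0 <= mu A)%E).

Definition points w : \bar R := (\sum_(i <oo) (\1_A (xi i w))%:E)%E.

Let pointsE w : points w = counting [set i | A (xi i w)].
Proof. by rewrite countingE. Qed.

Lemma measurable_points : measurable_fun setT points.
Proof.
apply: ge0_emeasurable_sum => // i _; apply/measurable_EFinP.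
by apply: measurableT_comp; [exact: measurable_indic|exact: measurable_funP].
Qed.

Let m := fine (mu A).
Let m0 : 0 <= m. Proof. exact: fine_ge0. Qed.
Let E k := [set w | points w = k%:R%:E].

Let mE k : measurable (E k).
Proof.
have := measurable_points measurableT (emeasurable_set1 k%:R%:E).
by rewrite setTI.
Qed.

Let PE k : P (E k) = (expR (- m) * m ^+ k / k`!%:R)%:E.
Proof.
have := pp (n := 1) (A := fun=> A) (fun=> k) (fun=> mA) _ (fun=> muA).
rewrite big_ord1 => <-.
  congr (P _); apply/seteqP; split => w; rewrite /E /= pointsE.
    by move=> h j.
  by move=> /(_ ord0).
by apply/trivIsetP => i j _ _; rewrite !ord1 eqxx.
Qed.

Let tE : trivIset setT E.
Proof.
apply/trivIsetP => i j _ _ ij; apply/seteqP; split=> // w /= [].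
rewrite /E /= => -> [] /eqP; rewrite eqr_nat => /eqP ji.
by rewrite ji eqxx in ij.
Qed.

Let PE1 : P (\bigcup_k E k) = 1%E.
Proof.
rewrite measure_bigcup//= (eq_eseriesl (Q := xpredT)) => [|i]; last by rewrite in_setT.
under eq_eseriesr do rewrite PE -mulrA EFinM.
rewrite nneseriesZl/=; last by move=> n _; rewrite lee_fin divr_ge0// exprn_ge0.
have -> : (\sum_(n <oo) (m ^+ n / n`!%:R)%:E)%E = (expR m)%:E.
  rewrite expRE -EFin_lim; last first.
    rewrite /pseries/=; under eq_fun do rewrite mulrC.
    exact: is_cvg_series_exp_coeff.
  apply/congr_lim/funext => n/=; rewrite /pseries/= /series/= -sumEFin//.
  by under [RHS]eq_bigr do rewrite mulrC.
by rewrite -EFinM -expRD addNr expR0.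
Qed.

(** An inequality form of Campbell's formula. The Poisson weights sum to 1, so almost surely the
    count is one of the integers [k]; its mean is then an explicit series. *)
Lemma integral_points : (\int[P]_w points w <= mu A)%E.
Proof.
have p0 w : (0 <= points w)%E by apply: nneseries_ge0 => i _ _; rewrite lee_fin.
have mU : measurable (\bigcup_k E k) by exact: bigcup_measurable.
have NU0 : P (~` \bigcup_k E k) = 0%E by rewrite probability_setC// PE1 subee.
rewrite (ge0_negligible_integral (measurableC mU) measurableT measurable_points
  (fun w _ => p0 w) NU0).
rewrite setTD setCK ge0_integral_bigcup//; last first.
  exact: measurable_funS measurable_points.
have -> : mu A = m%:E by rewrite fineK// ge0_fin_numE.
have iE k : (\int[P]_(w in E k) points w)%E =
    (k%:R * (expR (- m) * m ^+ k / k`!%:R))%:E.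
  rewrite (eq_integral (fun=> k%:R%:E)); last by move=> w; rewrite inE.
  by rewrite integral_cst// [X in (_ * X)%E]PE -EFinM.
under eq_eseriesr do rewrite iE.
(* The term [k = 0] vanishes and the factor [k] cancels in the factorial, which leaves the
   exponential series with one term less. *)
have partial n : \sum_(0 <= k < n) k%:R * (expR (- m) * m ^+ k / k`!%:R) =
    m * expR (- m) * \sum_(0 <= k < n.-1) exp_coeff m k.
  case: n => [|n]; first by rewrite !big_geq// mulr0.
  rewrite big_nat_recl//= mul0r add0r mulr_sumr; apply: eq_bigr => k _.
  rewrite /exp_coeff /= exprS factS natrM; field.
  by rewrite ?nat1r ?natr1 !pnatr_eq0 -?lt0n ?fact_gt0.
apply: lime_le.
  apply: is_cvg_nneseries => n _ _; rewrite lee_fin mulr_ge0// divr_ge0//.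
  by rewrite mulr_ge0 ?expR_ge0// exprn_ge0.
near=> n; rewrite sumEFin lee_fin partial.
rewrite -[leRHS]mulr1 -mulrA ler_wpM2l//.
rewrite -[leRHS](expRxMexpNx_1 m) mulrC ler_wpM2r ?expR_ge0//.
apply: (nondecreasing_cvgn_le (u_ := series (exp_coeff m))).
  by apply: nondecreasing_series => k _ _; exact: exp_coeff_ge0.
exact: is_cvg_series_exp_coeff.
Unshelve. all: by end_near. Qed.

End Campbell.

Lemma integral_lty_ae (f : T -> \bar R) : measurable_fun setT f ->
  (forall w, 0 <= f w)%E -> (\int[P]_w f w < +oo)%E ->
  {ae P, forall w, (f w < +oo)%E}.
Proof.
move=> mf f0 fy.
have intf : P.-integrable setT f.
  apply/integrableP; split => //.
  by under eq_integral do rewrite gee0_abs//.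
have := integrable_ae measurableT intf.
by apply: filterS => w /(_ I); rewrite ge0_fin_numE.
Qed.

(** * Summability of the limiting weights *)

Section Intensity.
Variables (p a : R).

Let K : R := if a == p then 2^-1 else 1.
Let K0 : 0 <= K. Proof. by rewrite /K; case: ifP. Qed.
Let K1 : K <= 1. Proof. by rewrite /K; case: ifP => // _; rewrite invf_le1 ?ler1n. Qed.

Let mint (A : set R) : measurable_fun A (fun x => (K * expR (- x))%:E).
Proof.
apply: measurable_funTS; apply/measurable_EFinP; apply: measurable_funM => //.
by apply: measurableT_comp => //; exact: oppr_measurable.
Qed.

Lemma xi_intensity_ge0 A : (0 <= xi_intensity p a A)%E.
Proof. by apply: integral_ge0 => x _; rewrite lee_fin mulr_ge0 ?expR_ge0. Qed.

Lemma xi_intensity_pos : (xi_intensity p a `]0%R, +oo[ <= 1)%E.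
Proof.
rewrite -(@integral_exponential_pdf R 1 ltr01).
have mpdf : measurable_fun setT (fun x : R => (exponential_pdf 1 x)%:E).
  by apply/measurable_EFinP; exact: measurable_exponential_pdf.
apply: (@le_trans _ _ (\int[lebesgue_measure]_(x in `]0%R, +oo[) (exponential_pdf 1 x)%:E)%E).
  apply: ge0_le_integral => //.
  - by move=> x _; rewrite lee_fin mulr_ge0 ?expR_ge0.
  - exact: mint.
  - exact: measurable_funTS mpdf.
  move=> x; rewrite /= in_itv /= andbT => x0; rewrite lee_fin exponential_pdfE ?(ltW x0)//=.
  by rewrite mul1r mulN1r ler_piMl ?expR_ge0.
apply: ge0_subset_integral => //.
by move=> x _; rewrite lee_fin exponential_pdf_ge0.
Qed.

(** The shells tile the half-line of nonpositive points. *)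
Definition shell (k : nat) : set R := `]- k.+1%:R, - k%:R]%classic.

Lemma xi_intensity_shell k : (xi_intensity p a (shell k) <= (expR k.+1%:R)%:E)%E.
Proof.
apply: (@le_trans _ _ (\int[lebesgue_measure]_(x in shell k) (expR k.+1%:R)%:E)%E).
  apply: ge0_le_integral => //.
  - exact: measurable_itv.
  - by move=> x _; rewrite lee_fin mulr_ge0 ?expR_ge0.
  - exact: mint.
  move=> x; rewrite /shell /= in_itv /= => /andP[xk _]; rewrite lee_fin.
  rewrite -[leRHS]mul1r ler_pM ?expR_ge0// ler_expR; lra.
have L1 : lebesgue_measure (shell k) = 1%E :> \bar R.
  rewrite /shell lebesgue_measure_itv /= lte_fin ltrN2 ltr_nat ltnSn -EFinD.
  by congr EFin; rewrite -natr1; ring.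
by rewrite integral_cst; [rewrite [X in (_ * X)%E]L1 mule1|exact: measurable_itv].
Qed.

(** There are finitely many positive points, each with weight at most that of the top one. A point
    of shell [k] weighs at most [expR (- (b * k))], and the mean number of such points is at most
    [expR k.+1]: a geometric series of ratio [expR (- (b - 1))]. *)
Lemma ae_sum_finite (b : R) (xi : nat -> {RV P >-> R}) : 1 < b ->
  ranked_poisson_process (xi_intensity p a) xi ->
  {ae P, forall w, (\sum_(0 <= i <oo) (expR (b * xi i w))%:E < +oo)%E}.
Proof.
move=> b1 [pp dec].
have mshell k : measurable (shell k) by exact: measurable_itv.
pose N k := points xi (shell k).
have N0 A w : (0 <= points xi A w)%E by apply: nneseries_ge0 => i _ _; rewrite lee_fin.
have mN A : measurable A -> measurable_fun setT (points xi A) by exact: measurable_points.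
pose S w := (\sum_(0 <= k <oo) (expR (- (b * k%:R)))%:E * N k w)%E.
have eN0 k w : (0 <= (expR (- (b * k%:R)))%:E * N k w)%E.
  by rewrite mule_ge0 ?N0// lee_fin expR_ge0.
have meN k : measurable_fun setT (fun w => (expR (- (b * k%:R)))%:E * N k w)%E.
  by apply: emeasurable_funM; [exact: measurable_cst|exact: (mN _ (mshell k))].
have S_fin : {ae P, forall w, (S w < +oo)%E}.
  apply: integral_lty_ae => [|w|].
  - by apply: ge0_emeasurable_sum => [k w _ _|k _]; [exact: eN0|exact: meN].
  - by apply: nneseries_ge0 => k _ _; exact: eN0.
  rewrite integral_nneseries; [|exact: measurableT|by move=> k; exact: meN|
    by move=> k w _; exact: eN0].
  pose z := expR (- (b - 1)).
  have z1 : `|z| < 1 by rewrite gtr0_norm ?expR_gt0// expR_lt1 oppr_lt0 subr_gt0.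
  apply: (@le_lt_trans _ _ (\sum_(0 <= k <oo) (geometric (expR 1) z k)%:E)%E).
    apply: lee_nneseries => k _ /=.
      by move=> _; apply: integral_ge0 => w _; exact: eN0.
    rewrite ge0_integralZl_EFin; [|exact: measurableT|by move=> w _; exact: N0|
      exact: (mN _ (mshell k))|exact: expR_ge0].
    apply: (@le_trans _ _ ((expR (- (b * k%:R)))%:E * (expR k.+1%:R)%:E)%E).
      rewrite lee_pmul2l ?lte_fin ?expR_gt0//.
      apply: le_trans (xi_intensity_shell k).
      apply: (integral_points pp) => //; last exact: xi_intensity_ge0.
      by rewrite (le_lt_trans (xi_intensity_shell k))// ltry.
    rewrite -EFinM lee_fin -expRD -expRM_natl -expRD -natr1 ler_expR; lra.
  have -> : (\sum_(0 <= k <oo) (geometric (expR 1) z k)%:E)%E =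
      (limn (series (geometric (expR 1) z)))%:E.
    rewrite -EFin_lim; last exact: is_cvg_geometric_series.
    by apply/congr_lim/funext => n /=; rewrite sumEFin.
  by rewrite ltry.
have N_fin : {ae P, forall w, (points xi `]0%R, +oo[%classic w < +oo)%E}.
  apply: integral_lty_ae => //; first exact: mN.
  have h : (xi_intensity p a `]0%R, +oo[ < +oo)%E.
    by rewrite (le_lt_trans xi_intensity_pos)// ltry.
  by rewrite (le_lt_trans _ h)// (integral_points pp)// xi_intensity_ge0.
apply: filterS3 S_fin N_fin dec => w Sw Nw decw.
have xi0 i : xi i w <= xi 0%N w.
  elim: i => // i IH; exact: le_trans (ltW (decw i)) IH.
pose c := expR (b * xi 0%N w).
(* Termwise, a positive point is charged to the first summand, any other one to the shell whose
   index is the integer part of [- xi i w]. *)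
apply: (@le_lt_trans _ _ (\sum_(0 <= i <oo) (c%:E * (\1_(`]0%R, +oo[%classic) (xi i w))%:E +
   \sum_(0 <= k <oo) (expR (- (b * k%:R)))%:E * (\1_(shell k) (xi i w))%:E))%E).
  apply: lee_nneseries => i _; first by rewrite lee_fin expR_ge0.
  have [x0|x0] := ltP 0 (xi i w).
    rewrite -[leLHS]adde0 leeD//.
      rewrite indicE mem_set /=; last by rewrite in_itv /= x0.
      by rewrite mule1 lee_fin ler_expR ler_pM2l ?xi0// (lt_trans ltr01).
    by apply: nneseries_ge0 => k _ _; rewrite mule_ge0// lee_fin ?expR_ge0.
  have x0' : 0 <= - xi i w by rewrite oppr_ge0.
  have /andP[k1 k2] := truncn_itv x0'.
  set k := Num.truncn _ in k1 k2.
  rewrite -[leLHS]add0e leeD//; first by rewrite mule_ge0// lee_fin ?expR_ge0.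
  apply: (@le_trans _ _ (\sum_(0 <= k' < k.+1) (expR (- (b * k'%:R)))%:E *
      (\1_(shell k') (xi i w))%:E)%E); last first.
    by apply: nneseries_lim_ge => k' _ _; rewrite mule_ge0// lee_fin ?expR_ge0.
  rewrite big_nat_recr//= -[leLHS]add0e leeD//.
    by apply: sume_ge0 => k' _; rewrite mule_ge0// lee_fin ?expR_ge0.
  rewrite indicE mem_set /=; last by rewrite /shell /= in_itv /=; apply/andP; split; lra.
  rewrite mule1 lee_fin ler_expR -mulrN ler_pM2l ?(lt_trans ltr01)//; lra.
rewrite nneseriesD => [|i _ _|i _ _]; last 2 first.
- by rewrite mule_ge0// lee_fin ?expR_ge0.
- by apply: nneseries_ge0 => k _ _; rewrite mule_ge0// lee_fin ?expR_ge0.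
rewrite lte_add_pinfty//.
  rewrite nneseriesZl; last by move=> i _; rewrite lee_fin.
  by rewrite lte_mul_pinfty// ?lee_fin ?expR_ge0.
rewrite nneseries_interchange; last first.
  by move=> i k; rewrite mule_ge0// lee_fin ?expR_ge0.
rewrite (_ : limn _ = S w)//; apply: eq_eseriesr => k _.
by rewrite nneseriesZl// => i _; rewrite lee_fin.
Qed.

End Intensity.

End LimitObjects.

(** * Asymptotics of the time scale *)

Section Asymptotics.
Context {R : realType}.
Notation sqN N := (Num.sqrt N%:R : R).

(** The eighth power of [x <= expR x] at [x = c / 8 * sqN N] is a multiple of [N ^+ 4], which beats
    the cube. That cube is the one in [total_resistance]. *)
Lemma cvg_poly_expN (c : R) : 0 < c ->
  (fun N => N%:R ^+ 3 * expR (- (c * sqN N))) @ \oo --> (0 : R).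
Proof.
move=> c0; pose C := (c / 8) ^- 8.
have C0 : 0 < C by rewrite invr_gt0 exprn_gt0// divr_gt0.
apply: (@squeeze_cvgr _ _ _ _ (fun=> 0) (fun N => C * N%:R^-1)).
- near=> N; have N0 : 0 < N%:R :> R by rewrite ltr0n; near: N; exact: nbhs_infty_gt.
  have s0 : 0 < sqN N by rewrite sqrtr_gt0.
  rewrite mulr_ge0 ?exprn_ge0 ?expR_ge0//=.
  have e1 : expR (- (c * sqN N)) = expR (c / 8 * sqN N) ^- 8.
    by rewrite -expRM_natl -expRN; congr expR; field.
  have e2 : (c / 8 * sqN N) ^+ 8 <= expR (c / 8 * sqN N) ^+ 8.
    have cs0 : 0 <= c / 8 * sqN N by rewrite mulr_ge0 ?divr_ge0 ?(ltW c0) ?(ltW s0).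
    rewrite lerXn2r ?nnegrE ?expR_ge0//.
    by apply: le_trans (expR_ge1Dx _); rewrite lerDr.
  have e3 : (c / 8 * sqN N) ^+ 8 = C^-1 * N%:R ^+ 4.
    rewrite exprMn /C invrK; congr (_ * _).
    by rewrite -[8%N]/(2 * 4)%N exprM sqr_sqrtr// ltW.
  rewrite e1 ler_pdivrMr ?exprn_gt0 ?expR_gt0//.
  apply: (@le_trans _ _ (C / N%:R * (C^-1 * N%:R ^+ 4))).
    rewrite le_eqVlt; apply/orP; left; apply/eqP; field.
    by rewrite !gt_eqF.
  by rewrite -e3 ler_wpM2l// divr_ge0// ltW.
- exact: cvg_cst.
- rewrite -[X in _ --> X](mulr0 C); apply: cvgMr.
  by rewrite -(cvg_shiftn 1) /=; under eq_fun do rewrite addn1; exact: cvg_harmonic.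
Unshelve. all: by end_near. Qed.

Lemma near_linear_sqrt (delta C : R) : 0 < delta ->
  \forall N \near \oo, - (delta * N%:R) + C * sqN N <= - (1 * sqN N).
Proof.
move=> d0; near=> N.
have s0 : 0 <= sqN N by exact: sqrtr_ge0.
have NE : N%:R = sqN N * sqN N by rewrite -expr2 sqr_sqrtr.
rewrite [X in delta * X]NE.
suff : (C + 1) / delta <= sqN N by rewrite ler_pdivrMr// => h; have := ler_wpM2r s0 h; lra.
have [C0|C0] := lerP ((C + 1) / delta) 0; first exact: le_trans s0.
rewrite -(@ler_pXn2r _ 2)// ?nnegrE ?(ltW C0)// sqr_sqrtr//.
by near: N; exact: nbhs_infty_ger.
Unshelve. all: by end_near. Qed.

Lemma cvg_exp_sqrt (c : R) : 0 < c -> (fun N => expR (- (c * sqN N))) @ \oo --> (0 : R).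
Proof.
move=> c0; apply: (@squeeze_cvgr _ _ _ _ (fun=> 0) (fun N => N%:R ^+ 3 * expR (- (c * sqN N)))).
- near=> N; rewrite expR_ge0/= ler_peMl ?expR_ge0// exprn_ege1// ler1n.
  by near: N; exact: nbhs_infty_gt.
- exact: cvg_cst.
- exact: cvg_poly_expN.
Unshelve. all: by end_near. Qed.

Variables (p a L beta t : R).
Hypotheses (p01 : 0 < p < 1) (a01 : 0 < a < 1) (t0 : 0 < t).
Hypothesis beta_int : beta_star < beta < beta_FT p a.

Definition theta (N : nat) : R :=
  t * expR (- (beta * (beta_star * a * N%:R + Num.sqrt (a * N%:R) * L))).

Lemma beta_star_gt0 : 0 < beta_star :> R.
Proof. by rewrite sqrtr_gt0 mulr_gt0// ln_gt0// ltr1n. Qed.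

Let beta_gt0 : 0 < beta.
Proof. by case/andP: beta_int => + _; exact: lt_trans beta_star_gt0. Qed.

Let a0 : 0 < a. Proof. by case/andP: a01. Qed.

Lemma theta_gt0 N : 0 < theta N.
Proof. by rewrite mulr_gt0 ?expR_gt0. Qed.

Let sqrt_aN N : Num.sqrt (a * N%:R) = Num.sqrt a * sqN N.
Proof. by rewrite sqrtrM// ltW. Qed.

Lemma theta_cvg0 : theta @ \oo --> 0.
Proof.
pose delta := beta * beta_star * a.
have d0 : 0 < delta by rewrite !mulr_gt0 ?beta_star_gt0.
apply: (@squeeze_cvgr _ _ _ _ (fun=> 0) (fun N => t * expR (- (1 * sqN N)))).
- near=> N; rewrite ltW ?theta_gt0//= /theta ler_pM2l// ler_expR.
  apply: le_trans (_ : - (delta * N%:R) + - (beta * Num.sqrt a * L) * sqN N <= _).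
    by rewrite sqrt_aN /delta le_eqVlt; apply/orP; left; apply/eqP; ring.
  by near: N; exact: near_linear_sqrt.
- exact: cvg_cst.
- by rewrite -[X in _ --> X](mulr0 t); apply: cvgMr; exact: cvg_exp_sqrt.
Unshelve. all: by end_near. Qed.

Lemma N1_le N : (N1 p N <= N)%N.
Proof.
case/andP: p01 => p0 p1.
rewrite -(ler_nat R); apply: le_trans (_ : p * N%:R <= _).
  by have /andP[] := truncn_itv (mulr_ge0 (ltW p0) (ler0n R N)).
by rewrite ler_piMl// ltW.
Qed.

(** Since [beta_star ^+ 2 = 2 * ln 2], the condition [beta < beta_FT p a] says exactly that the
    exponential rate [delta] is positive; the contribution of [L] is only of order [sqN N]. *)
Lemma block_cvg0 : (fun N => N%:R ^+ 3 * (2 ^- (N2 p N) / theta N)) @ \oo --> 0.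
Proof.
case/andP: p01 => p0 p1.
pose delta := (1 - p) * ln 2 - beta * beta_star * a.
have d0 : 0 < delta.
  case/andP: beta_int => _; rewrite /beta_FT -(ltr_pM2r (mulr_gt0 beta_star_gt0 a0)).
  have -> : (1 - p) / (2 * a) * beta_star * (beta_star * a) =
     (1 - p) / 2 * beta_star ^+ 2 :> R by field; rewrite gt_eqF.
  rewrite sqr_sqrtr; last by rewrite mulr_ge0// ln_ge0// ler1n.
  rewrite /delta; move: (ln 2 : R) => x; lra.
apply: (@squeeze_cvgr _ _ _ _ (fun=> 0)
  (fun N => t^-1 * (N%:R ^+ 3 * expR (- (1 * sqN N))))).
- near=> N; rewrite mulr_ge0 ?exprn_ge0 ?divr_ge0 ?(ltW (theta_gt0 _)) ?invr_ge0 ?exprn_ge0//=.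
  rewrite [leRHS]mulrCA ler_wpM2l ?exprn_ge0//.
  rewrite /theta invfM mulrCA ler_pM2l ?invr_gt0// -expRN opprK.
  have -> : 2 ^- N2 p N = expR (- ((N2 p N)%:R * ln 2)) :> R.
    by rewrite expRN expRM_natl lnK// posrE.
  rewrite -expRD ler_expR.
  apply: le_trans (_ : - (delta * N%:R) + (beta * Num.sqrt a * L) * sqN N <= _); last first.
    by near: N; exact: near_linear_sqrt.
  have n2 : (1 - p) * N%:R <= (N2 p N)%:R.
    rewrite /N2 natrB ?N1_le// mulrBl mul1r lerD2l lerN2.
    by have /andP[] := truncn_itv (mulr_ge0 (ltW p0) (ler0n R N)).
  have l2 : 0 <= ln 2 :> R by rewrite ln_ge0// ler1n.
  have := ler_wpM2r l2 n2; rewrite sqrt_aN /delta => h.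
  lra.
- exact: cvg_cst.
- by rewrite -[X in _ --> X](mulr0 t^-1); apply: cvgMr; exact: cvg_poly_expN.
Unshelve. all: by end_near. Qed.

Variables (g : nat -> R) (V : R).
Hypothesis g_cvg : (fun N => g N - Num.sqrt (a * N%:R) * beta_star) @ \oo --> V.

Let wt N := expR (beta * Num.sqrt (a * N%:R) * g N).

(** The terms linear in [N] cancel. What remains has an exponent of order [sqN N] with the sign of
    [V - L], which separates fast from slow ranks. *)
Let theta_wt N : theta N * wt N = t * expR (beta * Num.sqrt a *
  (g N - Num.sqrt (a * N%:R) * beta_star - L) * sqN N).
Proof.
rewrite /theta /wt -mulrA -expRD; congr (_ * expR _).
have aE : Num.sqrt a * Num.sqrt a = a by rewrite -expr2 sqr_sqrtr// ltW.
have NE : sqN N * sqN N = N%:R by rewrite -expr2 sqr_sqrtr.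
rewrite sqrt_aN -[X in - (_ * (beta_star * X * _ + _))]aE.
rewrite -[X in - (_ * (_ * X + _))]NE; ring.
Qed.

Lemma fast_cvg0 : L < V -> (fun N => N%:R ^+ 3 * (wt N)^-1 / theta N) @ \oo --> 0.
Proof.
move=> LV; pose h := (V - L) / 2.
have h0 : 0 < h by rewrite divr_gt0// subr_gt0.
have sa0 : 0 < Num.sqrt a by rewrite sqrtr_gt0.
have c0 : 0 < beta * Num.sqrt a * h by apply: mulr_gt0 => //; exact: mulr_gt0.
apply: (@squeeze_cvgr _ _ _ _ (fun=> 0)
  (fun N => t^-1 * (N%:R ^+ 3 * expR (- (beta * Num.sqrt a * h * sqN N))))).
- near=> N.
  rewrite mulr_ge0 ?mulr_ge0 ?exprn_ge0 ?invr_ge0 ?expR_ge0 ?(ltW (theta_gt0 _))//=.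
  rewrite -mulrA -invfM [wt N * _]mulrC theta_wt invfM [leRHS]mulrCA.
  rewrite ler_wpM2l ?exprn_ge0// ler_pM2l ?invr_gt0// -expRN ler_expR lerN2.
  rewrite ler_wpM2r ?sqrtr_ge0// ler_pM2l ?mulr_gt0//.
  have : V - h <= g N - Num.sqrt (a * N%:R) * beta_star.
    by near: N; apply: cvgr_ge g_cvg _ _; rewrite ltrBlDr ltrDl.
  by rewrite /h; lra.
- exact: cvg_cst.
- by rewrite -[X in _ --> X](mulr0 t^-1); apply: cvgMr; exact: cvg_poly_expN.
Unshelve. all: by end_near. Qed.

Lemma slow_cvg0 : V < L -> (fun N => theta N * wt N) @ \oo --> 0.
Proof.
move=> LV; pose h := (L - V) / 2.
have h0 : 0 < h by rewrite divr_gt0// subr_gt0.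
have sa0 : 0 < Num.sqrt a by rewrite sqrtr_gt0.
have c0 : 0 < beta * Num.sqrt a * h by apply: mulr_gt0 => //; exact: mulr_gt0.
apply: (@squeeze_cvgr _ _ _ _ (fun=> 0)
  (fun N => t * (expR (- (beta * Num.sqrt a * h * sqN N))))).
- near=> N.
  rewrite mulr_ge0 ?expR_ge0 ?(ltW (theta_gt0 _))//= theta_wt.
  have -> : - (beta * Num.sqrt a * h * sqN N) = beta * Num.sqrt a * - h * sqN N by ring.
  rewrite ler_pM2l// ler_expR ler_wpM2r ?sqrtr_ge0//.
  rewrite ler_pM2l ?mulr_gt0//.
  have : g N - Num.sqrt (a * N%:R) * beta_star <= V + h.
    by near: N; apply: cvgr_le g_cvg _ _; rewrite ltrDl.
  by rewrite /h; lra.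
- exact: cvg_cst.
- by rewrite -[X in _ --> X](mulr0 t); apply: cvgMr; exact: cvg_exp_sqrt.
Unshelve. all: by end_near. Qed.

End Asymptotics.

(** * The convergence of occupation times *)

Section Ranking.
Context {R : realType}.
Variables (p : R) (N : nat) (Xi : config p N -> R).
Hypothesis p01 : 0 < p < 1.

Lemma card_config : #|config p N| = (2 ^ N)%N.
Proof.
rewrite card_prod !card_ffun card_bool !card_ord -expnD /N2 subnKC//.
exact: N1_le.
Qed.

Lemma ranked_inj i j : (i < 2 ^ N)%N -> (j < 2 ^ N)%N ->
  ranked Xi i = ranked Xi j -> i = j.
Proof.
have szr : size (ranking Xi) = (2 ^ N)%N by rewrite size_sort -cardE card_config.
move=> i2 j2 /eqP; rewrite /ranked nth_uniq ?szr// => [/eqP//|].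
by rewrite sort_uniq enum_uniq.
Qed.

Lemma phi_ranked i : (i < 2 ^ N)%N ->
  (forall j, (j < i)%N -> (ranked Xi j).1 != (ranked Xi i).1) ->
  phi Xi (ranked Xi i) = i.
Proof.
have szr : size (ranking Xi) = (2 ^ N)%N by rewrite size_sort -cardE card_config.
move=> i2 dist; rewrite /phi; set P := fun s' => _; set r := ranking Xi.
have Pi : P (nth ([ffun=> true], [ffun=> true]) r i) by rewrite /P /=.
have fi : (find P r <= i)%N.
  by rewrite leqNgt; apply/negP => /(before_find ([ffun=> true], [ffun=> true])); rewrite Pi.
have hasP : has P r by rewrite has_find (leq_ltn_trans fi)// szr.
have := nth_find ([ffun=> true], [ffun=> true]) hasP.
move: fi; rewrite leq_eqVlt => /orP[/eqP//|fi].
by rewrite /P /= => /eqP E; have := dist _ fi; rewrite /ranked -/r E eqxx.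
Qed.

End Ranking.

Section Rates.
Context {R : realType}.
Variables (p a beta t L : R) (N : nat).
Variables (g1 : cube (N1 p N) -> R) (g2 : config p N -> R).
Hypotheses (N0 : (0 < N)%N) (a01 : 0 < a < 1).

Definition first_weight (s1 : cube (N1 p N)) : R :=
  expR (beta * Num.sqrt (a * N%:R) * g1 s1).

Lemma gammaN_gt0 Xi s : 0 < gammaN (p := p) (N := N) beta Xi s.
Proof. exact: expR_gt0. Qed.

Lemma gammaNE (Xi : config p N -> R) s : gammaN beta Xi s =
  expR (beta * Num.sqrt N%:R * Xi s) *
  expR (- (beta * (beta_star * N%:R - (ln N%:R + kappa) / (2 * beta_star)))).
Proof.
rewrite /gammaN -expRD; congr expR; rewrite /uN_inv.
have b0 := @beta_star_gt0 R.
have s0 : 0 < Num.sqrt N%:R :> R by rewrite sqrtr_gt0 ltr0n.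
have -> : beta_star * N%:R = beta_star * (Num.sqrt N%:R * Num.sqrt N%:R) :> R.
  by rewrite -expr2 sqr_sqrtr.
by field; rewrite !gt_eqF.
Qed.

(** Reversibility of the dynamics. The second-level rate contains only [g2]; completing it to the
    full energy [XiN] leaves the factor [first_weight], which is constant on a block. *)
Lemma rate_two_level (s s' : config p N) :
  cN a beta L N * t * rate a beta g1 g2 s s' =
  two_level (theta a L beta t N / N%:R) first_weight s s' /
    gammaN beta (XiN a g1 g2) s.
Proof.
rewrite gammaNE /cN /theta.
set X := expR (beta * (_ - _)); have X0 : 0 < X by exact: expR_gt0.
rewrite [expR (- (beta * (_ - _)))]expRN -/X invfM invrK.
set Y := expR (- (beta * (_ + _))).
have /andP[a0 a1] := a01.
rewrite /rate /two_level; case: ifP => _.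
  by rewrite expRN; field; rewrite !gt_eqF ?ltr0n// expR_gt0.
case: ifP => _; last by rewrite mulr0 mul0r.
have -> : expR (- (beta * Num.sqrt ((1 - a) * N%:R) * g2 s)) =
    first_weight s.1 * (expR (beta * Num.sqrt N%:R * XiN a g1 g2 s))^-1.
  rewrite /first_weight -expRN -expRD; congr expR.
  by rewrite /XiN !sqrtrM ?subr_ge0 ?ltW//; ring.
by field; rewrite !gt_eqF ?ltr0n// expR_gt0.
Qed.

End Rates.

(** * The dynamics in a fixed convergent environment *)

Section FixedEnvironment.
Context {R : realType}.
Variables (p a L beta t : R).
Hypotheses (p01 : 0 < p < 1) (a01 : 0 < a < 1) (t0 : 0 < t).
Hypothesis beta_int : beta_star < beta < beta_FT p a.
Variables (g1 : forall N, cube (N1 p N) -> R) (g2 : forall N, config p N -> R).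
Variables (xi W : nat -> R).
Hypothesis sk : skorohod_convergence a beta g1 g2 xi W.
Hypothesis sum_fin : (\sum_(0 <= i <oo) (expR (beta / beta_star * xi i))%:E < +oo)%E.
Hypothesis WL : forall i, W i != L.

Let Xi N := XiN a (@g1 N) (@g2 N).
Arguments Xi : clear implicits.
Let gm N := gammaN beta (Xi N).
Arguments gm : clear implicits.
Let s N i := ranked (Xi N) i.
Let gamma i := expR (beta / beta_star * xi i).

Lemma cvg_gamma i : (fun N => gm N (s N i)) @ \oo --> gamma i.
Proof.
case: sk => h _ _ _; rewrite /gm /gammaN /gamma.
apply: (@cvg_comp _ _ _ _ expR); last exact: continuous_expR.
by apply: cvgMr; exact: h.
Qed.

Lemma near_card M : \forall N \near \oo, (M <= 2 ^ N)%N.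
Proof.
near=> N; apply: (@leq_trans N); first by near: N; exact: nbhs_infty_ge.
by rewrite ltnW// ltn_expl.
Unshelve. all: by end_near. Qed.

(** In a common block, the block sum would dominate both weights, whose limits add up to
    [gamma i + gamma j]; but it tends to [gamma i] alone. *)
Lemma near_distinct i j : i != j -> \forall N \near \oo, (s N i).1 != (s N j).1.
Proof.
move=> ij; case: sk => _ _ hb _.
have h : (fun N => \sum_s2 gm N ((s N i).1, s2) - gm N (s N i) - gm N (s N j)) @ \oo
    --> gamma i - gamma i - gamma j.
  apply: cvgB; last exact: cvg_gamma.
  by apply: cvgB; [exact: hb|exact: cvg_gamma].
have neg : \forall N \near \oo,
    \sum_s2 gm N ((s N i).1, s2) - gm N (s N i) - gm N (s N j) < 0.
  by apply: (cvgr_lt _ h); rewrite subrr sub0r oppr_lt0 expR_gt0.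
near=> N; apply/eqP => E.
have : \sum_s2 gm N ((s N i).1, s2) - gm N (s N i) - gm N (s N j) < 0 by near: N.
apply/negP; rewrite -leNgt.
have s12 : (s N i).2 != (s N j).2.
  apply: contra ij => /eqP E2; apply/eqP/(@ranked_inj _ p N (Xi N) p01).
  - by near: N; exact: (near_card i.+1).
  - by near: N; exact: (near_card j.+1).
  by move: E E2; rewrite /s; case: (ranked _ i) (ranked _ j) => [? ?] [? ?] /= -> ->.
rewrite (bigD1 (s N i).2)//= (bigD1 (s N j).2) 1?eq_sym//=.
have -> : gm N ((s N i).1, (s N i).2) = gm N (s N i) by rewrite -surjective_pairing.
have -> : gm N ((s N i).1, (s N j).2) = gm N (s N j) by rewrite E -surjective_pairing.
have : 0 <= \sum_(s2 | (s2 != (s N i).2) && (s2 != (s N j).2)) gm N ((s N i).1, s2).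
  by apply: sumr_ge0 => ? _; rewrite ltW// gammaN_gt0.
lra.
Unshelve. all: by end_near. Qed.

Let th := theta a L beta t.
Let th_gt0 N : 0 < th N. Proof. exact: theta_gt0. Qed.
Let wt N i := first_weight a beta (@g1 N) (s N i).1.
Let S : R := fine (\sum_(0 <= i <oo) (gamma i)%:E)%E.

Section Truncation.
Variables (M : nat) (K kap : R) (l : nat).
Hypotheses (lM : (l < M)%N) (lL : L < W l) (K0 : 0 < K) (kap0 : 0 < kap).

Definition fast_ranks := [seq i <- index_iota 0 M | L < W i].
Definition slow_ranks := [seq i <- index_iota 0 M | W i < L].

(** A sum rather than a maximum: it dominates the bound of [grounded_two_level] at every fast rank
    and converges termwise. The cube of [N] is the square from that bound times the [N] in the
    conductance [th N / N]. *)
Definition total_resistance N : R := \sum_(i <- fast_ranks)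
  4 * (N%:R ^+ 3 * (2 ^- (N2 p N) / th N) + N%:R ^+ 3 * (wt N i)^-1 / th N).

Definition slow_conductance N : R := \sum_(i <- slow_ranks) (th N + th N * wt N i).

Definition tail_mass N : R :=
  \sum_x gm N x - \sum_(0 <= i < M) gm N (s N i).

(** The bound of [occupation_bound] with the fast ranks as [A] and the slow ranks as [B], where [M]
    dominates the cardinality of [B]. *)
Definition error_bound N : R :=
  2 * (expR 2 * (M%:R / 2 ^+ N + (2 / gm N (s N l) + total_resistance N) / K +
    K * slow_conductance N + K * tail_mass N)) +
  \sum_(i <- fast_ranks) gm N (s N i) * (kap + kap^-1 *
    (2 * ((gm N (s N l))^-1 + (gm N (s N i))^-1) * (8 * total_resistance N))).

Lemma cvg_total_resistance : total_resistance @ \oo --> 0.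
Proof.
have -> : 0 = \sum_(i <- fast_ranks) 4 * (0 + 0) :> R.
  by rewrite big1// => i _; rewrite addr0 mulr0.
apply: cvgr_sum => i; rewrite mem_filter => /andP[LW _].
apply: cvgMr; apply: cvgD; first exact: block_cvg0.
case: sk => _ hW _ _.
exact: (fast_cvg0 a01 t0 beta_int (hW i) LW).
Qed.

Lemma cvg_slow_conductance : slow_conductance @ \oo --> 0.
Proof.
have -> : 0 = \sum_(i <- slow_ranks) (0 + 0) :> R.
  by rewrite big1// => i _; rewrite addr0.
apply: cvgr_sum => i; rewrite mem_filter => /andP[LW _].
apply: cvgD; first exact: (theta_cvg0 L a01 t0 beta_int).
case: sk => _ hW _ _.
exact: (slow_cvg0 a01 t0 beta_int (hW i) LW).
Qed.

Lemma cvg_tail_mass : tail_mass @ \oo --> S - \sum_(0 <= i < M) gamma i.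
Proof.
case: sk => _ _ _ hS; apply: cvgB.
  apply: (@fine_cvg _ _ _ _ (fun N => (\sum_x gm N x)%:E)).
  rewrite fineK//; rewrite ge0_fin_numE//.
  by apply: nneseries_ge0 => i _ _; rewrite lee_fin expR_ge0.
by apply: cvgr_sum => i _; exact: cvg_gamma.
Qed.

(** The surviving terms are made small by a large [K], then a large [M] depending on [K], and a
    small [kap]. *)
Lemma cvg_error_bound : error_bound @ \oo -->
  2 * (expR 2 * ((2 / gamma l) / K + K * (S - \sum_(0 <= i < M) gamma i))) +
  \sum_(i <- fast_ranks) gamma i * kap.
Proof.
have cR := cvg_total_resistance.
have ci i : (fun N => (gm N (s N i))^-1) @ \oo --> (gamma i)^-1.
  by apply: cvgV; [exact: lt0r_neq0 (expR_gt0 _)|exact: cvg_gamma].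
have c2 : (fun N => M%:R / 2 ^+ N : R) @ \oo --> (0 : R).
  rewrite -[X in _ --> X](mulr0 M%:R); apply: cvgMr.
  under eq_fun do rewrite -exprVn.
  by apply: cvg_expr; rewrite ger0_norm ?invr_ge0// invf_lt1// ltr1n.
rewrite [X in _ --> X](_ : _ = 2 * (expR 2 * (0 + (2 * (gamma l)^-1 + 0) / K + K * 0 +
    K * (S - \sum_(0 <= i < M) gamma i))) +
  \sum_(i <- fast_ranks) gamma i * (kap + kap^-1 * (2 * ((gamma l)^-1 + (gamma i)^-1) * (8 * 0)))).
  apply: cvgD.
    apply: cvgMr; apply: cvgMr; apply: cvgD; last by apply: cvgMr; exact: cvg_tail_mass.
    apply: cvgD; last by apply: cvgMr; exact: cvg_slow_conductance.
    apply: cvgD => //; apply: cvgMl; apply: cvgD => //.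
    by apply: cvgMr; exact: ci.
  apply: cvgr_sum => i _; apply: cvgM; first exact: cvg_gamma.
  apply: cvgD; first exact: cvg_cst.
  apply: cvgMr; apply: cvgM; last by apply: cvgMr.
  by apply: cvgMr; apply: cvgD; exact: ci.
rewrite !mulr0 addr0 add0r addr0; congr (_ + _).
by apply: eq_bigr => i _; rewrite !mulr0 addr0.
Qed.

Section Dynamics.
Variables (dD : nat -> measure_display) (D : forall N, measurableType (dD N)).
Variable Q : forall N, probability (D N) R.
Variable sigma : forall N, R -> D N -> config p N.
Hypothesis dyn : forall N,
  markov_jump_process (Q N) (rate a beta (@g1 N) (@g2 N)) (@sigma N).

Definition fraction N v : R :=
  occupation (cN a beta L N * t) (fun u => phi (Xi N) (sigma u v)) l.

(** Since no [W i] equals [L], a state that is neither in [A] nor in [B] has rank at least [M], so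
    its weight is part of [tail_mass]. *)
Lemma near_occupation : \forall N \near \oo,
  bounded_measurable (@fraction N) /\
  Ex (Q N) (fun v => `|fraction v - gm N (s N l) /
    \sum_(i <- fast_ranks) gm N (s N i)|) <= error_bound N.
Proof.
near=> N.
have N0 : (0 < N)%N by near: N; exact: nbhs_infty_gt.
have NR0 : 0 < N%:R :> R by rewrite ltr0n.
have card : (M <= 2 ^ N)%N by near: N; exact: near_card.
have dist i j : (i < M)%N -> (j < M)%N -> i != j -> (s N i).1 != (s N j).1.
  move=> iM jM ij.
  (* Ordinals make this a finite intersection of eventual events. *)
  have : forall i j : 'I_M, i != j :> nat -> (s N i).1 != (s N j).1.
    near: N; apply: filter_forall => i'; apply: filter_forall => j'.
    have [->|ij'] := eqVneq (i' : nat) j'; first by near=> N.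
    by have := near_distinct ij'; apply: filterS => N h _.
  by move/(_ (Ordinal iM) (Ordinal jM) ij).
have sinj : {in index_iota 0 M &, injective (s N)}.
  move=> i j; rewrite !mem_index_iota /= => iM jM.
  by apply: ranked_inj => //; exact: leq_trans card.
have sub (P : pred nat) : uniq (map (s N) [seq i <- index_iota 0 M | P i]).
  rewrite map_inj_in_uniq ?filter_uniq ?iota_uniq// => i j.
  rewrite !mem_filter => /andP[_ +] /andP[_]; exact: sinj.
pose rk (P : pred nat) : {set config p N} :=
  [set x in map (s N) [seq i <- index_iota 0 M | P i]]%SET.
have rkE (P : pred nat) F : \sum_(x in rk P) F x =
    \sum_(i <- [seq i <- index_iota 0 M | P i]) F (s N i) :> R.
  transitivity (\sum_(x in map (s N) [seq i <- index_iota 0 M | P i]) F x).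
    by apply: eq_bigl => x; rewrite inE.
  by rewrite -big_uniq// big_map.
pose A := rk (fun i => L < W i); pose B := rk (fun i => W i < L).
pose T := cN a beta L N * t.
have T0 : 0 < T by rewrite /T mulr_gt0// mulr_gt0 ?expR_gt0.
pose k := th N / N%:R.
have k0 : 0 < k by rewrite divr_gt0.
have wt0 s1 : 0 < first_weight a beta (@g1 N) s1 by exact: expR_gt0.
have n1 := N1_le p01 N; have n2 : (N2 p N <= N)%N by exact: leq_subr.
pose c := two_level (n2 := N2 p N) k (first_weight a beta (@g1 N)).
have nc : network c by exact: network_two_level.
have gr : {in A, forall x, grounded c (total_resistance N) x}.
  move=> x; rewrite inE => /mapP [i iI ->] f.
  apply: le_trans (grounded_two_level k0 wt0 n1 n2 (s N i) f) _.
  rewrite ler_wpM2r ?energy_ge0//.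
  rewrite /total_resistance (big_rem i)//= -[leLHS]addr0 lerD//.
    rewrite le_eqVlt; apply/orP; left; apply/eqP; rewrite /k -/(wt N i); field.
    by rewrite !gt_eqF ?exprn_gt0 ?expR_gt0.
  by apply: sumr_ge0 => j _; rewrite mulr_ge0// addr_ge0// ?mulr_ge0 ?divr_ge0//
    ?invr_ge0 ?exprn_ge0 ?expR_ge0 ?(ltW (th_gt0 _)).
have R0 : 0 <= total_resistance N.
  by apply: sumr_ge0 => j _; rewrite mulr_ge0// addr_ge0// ?mulr_ge0 ?divr_ge0//
    ?invr_ge0 ?exprn_ge0 ?expR_ge0 ?(ltW (th_gt0 _)).
have lI : l \in fast_ranks by rewrite mem_filter lL mem_index_iota.
have lA : s N l \in A by rewrite inE map_f.
(* All states in the block of [s N l] have label [l], but [A] meets each block at most once; outside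
   [A] the test is unrestricted in [occupation_bound]. *)
have bA : {in A, forall x, (phi (Xi N) x == l) = (x == s N l)}.
  move=> x; rewrite inE => /mapP [i]; rewrite mem_filter mem_index_iota /= => /andP[_ iM] ->.
  rewrite [phi _ _](phi_ranked p01); last 2 first.
  - exact: leq_trans card.
  - move=> j ji; apply: dist => //; first exact: ltn_trans iM.
    by rewrite ltn_eqF.
  by apply/eqP/eqP => [->//|]; apply: sinj; rewrite mem_index_iota.
have rc x y : x != y -> T * rate a beta (@g1 N) (@g2 N) x y = c x y / gm N x.
  by move=> _; exact: rate_two_level.
have [bY] := occupation_bound (dyn N) T0 nc (gammaN_gt0 beta (Xi N)) rc B lA bA R0 gr K0 kap0.
move=> EY; split; first exact: bY.
rewrite -(rkE (fun i => L < W i)); apply: le_trans EY _.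
rewrite /error_bound -(rkE (fun i => L < W i) (fun x => gm N x * (kap + kap^-1 *
    (2 * ((gm N (s N l))^-1 + (gm N x)^-1) * (8 * total_resistance N))))).
rewrite lerD2r ler_wpM2l// ler_wpM2l ?expR_ge0//.
rewrite lerD//; last first.
  rewrite ler_pM2l// /tail_mass.
  have -> : \sum_(0 <= i < M) gm N (s N i) = \sum_(x in rk xpredT) gm N x.
    by rewrite rkE filter_predT.
  rewrite [X in _ <= X - _](bigID (mem (rk xpredT)))/= addrAC subrr add0r.
  rewrite big_mkcond [leRHS]big_mkcond; apply: ler_sum => x _.
  have g0 := gammaN_gt0 beta (Xi N) x.
  case: ifPn => [xAB|_]; last by case: ifPn => // _; exact: ltW.
  case: ifPn => // /negPn; rewrite inE => /mapP [i iM xi'].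
  move: xAB; rewrite !inE xi' => /andP[/negP nB /negP nA].
  have := WL i; rewrite neq_lt => /orP[iL|iL].
    by exfalso; apply: nB; rewrite map_f// mem_filter iL; move: iM; rewrite mem_filter.
  by exfalso; apply: nA; rewrite map_f// mem_filter iL; move: iM; rewrite mem_filter.
rewrite lerD//; last first.
  rewrite ler_pM2l// rkE; apply: ler_sum => i _.
  apply: le_trans (sum_two_level k0 wt0 n1 n2 (s N i)) _.
  rewrite /k -/(wt N i) le_eqVlt; apply/orP; left; apply/eqP; field.
  by rewrite gt_eqF.
rewrite lerD2r (card_config N p01) natrX ler_wpM2r ?invr_ge0 ?exprn_ge0// ler_nat.
rewrite (leq_trans (_ : _ <= size (map (s N) slow_ranks))%N)//.
  by rewrite cardsE; exact: card_size.
rewrite size_map size_filter (leq_trans (count_size _ _))//.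
by rewrite size_iota subn0.
Unshelve. all: by end_near. Qed.

End Dynamics.
End Truncation.

Lemma cvg_partial_sums (P : pred nat) :
  (fun n => \sum_(0 <= i < n | P i) gamma i) @ \oo -->
  fine (\sum_(0 <= i <oo | P i) (gamma i)%:E)%E.
Proof.
have g0 i : (0 <= (gamma i)%:E)%E by rewrite lee_fin expR_ge0.
have fin : (\sum_(0 <= i <oo | P i) (gamma i)%:E)%E \is a fin_num.
  rewrite ge0_fin_numE; last by apply: nneseries_ge0 => i _ _; exact: g0.
  apply: le_lt_trans sum_fin; rewrite eseries_mkcond.
  by apply: lee_nneseries => i _ //; case: ifP.
apply: (@fine_cvg _ _ _ _ (fun n => (\sum_(0 <= i < n | P i) gamma i)%:E)).
rewrite fineK//; under eq_fun do rewrite -sumEFin.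
by apply: is_cvg_nneseries => i _ _; exact: g0.
Qed.

Section Limit.
Variables (dD : nat -> measure_display) (D : forall N, measurableType (dD N)).
Variable Q : forall N, probability (D N) R.
Variable sigma : forall N, R -> D N -> config p N.
Hypothesis dyn : forall N,
  markov_jump_process (Q N) (rate a beta (@g1 N) (@g2 N)) (@sigma N).

Lemma occupation_cvg l : L < W l ->
  converges_in_probability Q
    (fun N v => occupation (cN a beta L N * t) (fun u => phi (Xi N) (@sigma N u v)) l)
    (pi_limit beta L xi W l).
Proof.
move=> lL e e0; set pi := pi_limit _ _ _ _ _.
pose F n := \sum_(0 <= i < n | L < W i) gamma i.
pose Foo := fine (\sum_(0 <= i <oo | (L < W i)%R) (gamma i)%:E)%E.
have FF : F @ \oo --> Foo by exact: cvg_partial_sums.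
have gl0 : 0 < gamma l by exact: expR_gt0.
have Foo0 : 0 < Foo.
  apply: lt_le_trans gl0 _; apply: (cvgr_to_ge FF); near=> n.
  have ln : (l < n)%N by near: n; exact: nbhs_infty_gt.
  rewrite /F big_mkcond (bigD1_seq l) ?mem_index_iota ?iota_uniq//= lL.
  by rewrite lerDl sumr_ge0// => i _; case: ifP => // _; exact: expR_ge0.
have S0 : 0 <= S by apply: fine_ge0; apply: nneseries_ge0 => i _ _; rewrite lee_fin expR_ge0.
have piE : (fun n => gamma l / F n) @ \oo --> pi.
  by apply: cvgMr; apply: cvgV => //; exact: lt0r_neq0.
apply/fine_cvgP; split.
  (* Only the measurability part is used here, so the parameters are arbitrary. *)
  have := near_occupation (l := l) (M := l.+1) (ltnSn l) lL ltr01 ltr01 dyn.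
  apply: filterS => N [bY _]; apply: fin_num_measure.
  have [mY _] := bm_norm (bmB bY (bm_cst pi)).
  have := mY measurableT _ (measurable_itv `]e, +oo[); rewrite setTI.
  by congr measurable; apply/seteqP; split => v /=; rewrite in_itv/= andbT.
apply/cvgrPdist_le => eta eta0.
(* By Markov's inequality a mean error of at most [zeta] gives probability at most [eta]. The budget
   is [7 / 10] for [error_bound], whose limit is at most [3 / 5], and [3 / 10] for the distance to
   [pi], whose limit is at most [1 / 5]. *)
pose zeta := e * eta; have z0 : 0 < zeta by exact: mulr_gt0.
(* Chosen so that the term in [K^-1] of the limit equals [zeta / 5]. *)
pose K := 20 * expR 2 / (gamma l * zeta).
have E0 : 0 < expR 2 :> R by exact: expR_gt0.
have K0 : 0 < K by rewrite divr_gt0 ?mulr_gt0.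
(* Since [F M <= S + 1] for every [M], the last sum of the limit is at most [zeta / 5], whatever [M]
   is chosen later. *)
pose kap := zeta / (5 * (S + 1)).
have S1 : 0 < S + 1 by rewrite ltr_wpDl.
have kap0 : 0 < kap by rewrite divr_gt0// mulr_gt0.
have [M [lM tailM piM]] : exists M, [/\ (l < M)%N,
    2 * (expR 2 * (K * (S - \sum_(0 <= i < M) gamma i))) <= zeta / 5 &
    `|gamma l / F M - pi| <= zeta / 5].
  have c1 : (fun M => 2 * (expR 2 * (K * (S - \sum_(0 <= i < M) gamma i)))) @ \oo -->
      2 * (expR 2 * (K * (S - S))).
    do 3 apply: cvgMr; apply: cvgB; first exact: cvg_cst.
    exact: cvg_partial_sums.
  have c2 : (fun M => `|gamma l / F M - pi|) @ \oo --> `|pi - pi|.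
    by apply: cvg_norm; apply: cvgB => //; exact: cvg_cst.
  apply: (@filter_ex _ \oo); near=> M; split.
  - by near: M; exact: nbhs_infty_gt.
  - by near: M; apply: (cvgr_le _ c1); rewrite subrr !mulr0 divr_gt0.
  - by near: M; apply: (cvgr_le _ c2); rewrite subrr normr0 divr_gt0.
have FM : \sum_(i <- fast_ranks M) gamma i = F M by rewrite big_filter.
have lI : l \in fast_ranks M by rewrite mem_filter lL mem_index_iota.
have FM0 : 0 < F M.
  rewrite -FM (big_rem l)//= ltr_pwDl// sumr_ge0// => i _; exact: expR_ge0.
have FMS : F M <= S + 1.
  apply: (@le_trans _ _ (\sum_(0 <= i < M) gamma i)).
    rewrite /F big_mkcond; apply: ler_sum => i _; case: ifP => // _; exact: expR_ge0.
  rewrite -subr_ge0; suff : 0 <= S - \sum_(0 <= i < M) gamma i by lra.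
  rewrite subr_ge0 -lee_fin -sumEFin fineK; last first.
    rewrite ge0_fin_numE//.
    by apply: nneseries_ge0 => i _ _; rewrite lee_fin expR_ge0.
  by apply: nneseries_lim_ge => i _ _; rewrite lee_fin expR_ge0.
have bound_lim : error_bound M K kap l @ \oo -->
    2 * (expR 2 * (2 / gamma l / K + K * (S - \sum_(0 <= i < M) gamma i))) +
    \sum_(i <- fast_ranks M) gamma i * kap by exact: cvg_error_bound.
have limit_le : 2 * (expR 2 * (2 / gamma l / K + K * (S - \sum_(0 <= i < M) gamma i))) +
    \sum_(i <- fast_ranks M) gamma i * kap <= zeta / 5 * 3.
  rewrite -mulr_suml FM mulrDr mulrDr.
  have -> : 2 * (expR 2 * (2 / gamma l / K)) = zeta / 5.
    by rewrite /K; field; rewrite !gt_eqF.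
  have : F M * kap <= zeta / 5.
    have -> : zeta / 5 = (S + 1) * kap by rewrite /kap; field; rewrite gt_eqF.
    by rewrite ler_wpM2r// ltW.
  move: tailM; lra.
have pi_lim : (fun N => `|gm N (s N l) / \sum_(i <- fast_ranks M) gm N (s N i) - pi|) @ \oo
   --> `|gamma l / F M - pi|.
  apply: cvg_norm; apply: cvgB; last exact: cvg_cst.
  apply: cvgM; first exact: cvg_gamma.
  apply: cvgV; first exact: lt0r_neq0.
  by rewrite -FM; apply: cvgr_sum => i _; exact: cvg_gamma.
near=> N.
have [bY EY] : bounded_measurable (@fraction l _ D sigma N) /\
  Ex (Q N) (fun v => `|fraction l sigma v - gm N (s N l) /
    \sum_(i <- fast_ranks M) gm N (s N i)|) <= error_bound M K kap l N.
  by near: N; exact: near_occupation.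
have bN : error_bound M K kap l N <= zeta * (7 / 10).
  by near: N; apply: (cvgr_le _ bound_lim); apply: (le_lt_trans limit_le); lra.
have pN : `|gm N (s N l) / \sum_(i <- fast_ranks M) gm N (s N i) - pi| <= zeta * (3 / 10).
  by near: N; apply: (cvgr_le _ pi_lim); apply: (le_lt_trans piM); lra.
rewrite /= sub0r normrN ger0_norm ?fine_ge0//.
have bZ := bmB bY (bm_cst pi).
have := Markov_le (Q N) bZ e0.
set q := Q N _ => hq.
have qfin : q \is a fin_num.
  by rewrite ge0_fin_numE ?measure_ge0//; exact: (le_lt_trans hq (ltry _)).
change (fine q <= eta).
rewrite -lee_fin fineK//; apply: (le_trans hq).
rewrite lee_fin ler_pdivrMr// [leRHS]mulrC -/zeta.
set pi' := gm N (s N l) / _ in EY pN.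
apply: (@le_trans _ _ (Ex (Q N) (fun v => `|fraction l sigma v - pi'| + `|pi' - pi|))).
  apply: Ex_le => [||v]; first exact: bm_norm.
  - by apply: bmD; [apply: bm_norm; apply: bmB => //; exact: bm_cst|exact: bm_cst].
  have -> : fraction l sigma v - pi = (fraction l sigma v - pi') + (pi' - pi) by ring.
  exact: ler_normD.
rewrite ExD ?Ex_cst; [lra| |exact: bm_cst].
by apply: bm_norm; apply: bmB => //; exact: bm_cst.
Unshelve. all: by end_near. Qed.

End Limit.

End FixedEnvironment.

Theorem theorem1p7 (R : realType) (p a L beta t : R)
  (p01 : 0 < p < 1) (a01 : 0 < a < 1) (a_le_p : a <= p)
  (FT : beta_star < beta_FT p a)
  (L_neg : a = p -> L < 0)
  (beta_int : beta_star < beta < beta_FT p a)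
  (t_gt0 : 0 < t)
  (* probability space carrying the environments and the limit objects *)
  (d : measure_display) (Omega : measurableType d) (P : probability Omega R)
  (g1 : forall N, cube (N1 p N) -> {RV P >-> R})
  (g2 : forall N, config p N -> {RV P >-> R})
  (xi W : nat -> {RV P >-> R})
  (env : forall N, gaussian_disorder (g1 N) (g2 N))
  (lim_obj : limit_objects p a xi W)
  (skorohod : {ae P, forall w, skorohod_convergence a beta
     (fun N s1 => g1 N s1 w) (fun N s => g2 N s w) (xi ^~ w) (W ^~ w)})
  (* dynamics, given the environment w *)
  (dD : nat -> measure_display) (D : forall N, measurableType (dD N))
  (Q : forall N, Omega -> probability (D N) R)
  (sigma : forall N, Omega -> R -> D N -> config p N)
  (dyn : forall N w, markov_jump_process (Q N w)
     (rate a beta (fun s1 => g1 N s1 w) (fun s => g2 N s w)) (sigma N w)) :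
  {ae P, forall w, forall l : nat, L < W l w ->
     converges_in_probability (fun N => Q N w)
       (fun N v => occupation (cN a beta L N * t)
          (fun s => phi (XiN a (fun s1 => g1 N s1 w) (fun s' => g2 N s' w))
                      (sigma N w s v)) l)
       (pi_limit beta L (xi ^~ w) (W ^~ w) l)}.
Proof.
have [rpp _ _ _] := lim_obj.
have b1 : 1 < beta / beta_star.
  by rewrite ltr_pdivlMr ?beta_star_gt0// mul1r; case/andP: beta_int.
(* On these three almost sure events the rest of the argument is deterministic in the environment,
   and holds for all [l] at once. *)
apply: filterS3 skorohod (ae_sum_finite b1 rpp) (ae_W_neq L lim_obj).
move=> w sk sum_fin WL l lL.
exact: (occupation_cvg p01 a01 t_gt0 beta_int sk sum_fin WL (dyn ^~ w) lL).
Qed.
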